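(* Assume that $k$, $\rho$, $c$ and $v$ (with $v(T)=\mu(T)/\sqrt t$) are such that the boundedness and Lipschitz hypotheses (K), (R), (V) listed in the context hold. Let $\lambda_{1q}$ be the unique solution of $\mathcal V_1^q(\lambda)=\lambda$, $\lambda>0$, and let $\lambda_{2q}>\lambda_{1q}$ be the unique solution of $\mathcal V_2^q(\lambda)=\lambda$, $\lambda>0$. If $\mathcal E_q(\lambda_{2q})<1$, then there exists at least one solution $(T,s)$ to the Stefan problem $$\rho(T)c(T)\frac{\partial T}{\partial t}=\frac{\partial}{\partial x}\Big(k(T)\frac{\partial T}{\partial x}\Big)-v(T)\frac{\partial T}{\partial x},\quad 0<x<s(t),\ t>0,$$ $$k(T(0,t))\frac{\partial T}{\partial x}(0,t)=-\frac{q}{\sqrt t},\quad T(s(t),t)=T_m,\quad k(T(s(t),t))\frac{\partial T}{\partial x}(s(t),t)=-\rho_0\ell\,\dot s(t),\quad t>0,\quad s(0)=0,$$ where the free boundary is given by $s(t)=2\widetilde\lambda_q\sqrt{\alpha_0t}$, $t>0$, with $\widetilde\lambda_q\in(\lambda_{1q},\lambda_{2q})$ a solution of $\mathcal V^q(\lambda)=\lambda$, and the temperature is given by $$T(x,t)=T_mf_{\widetilde\lambda_q}(\xi)+T_m,\qquad \xi=\frac{x}{2\sqrt{\alpha_0t}},\quad 0\le\xi\le\widetilde\lambda_q,$$ where $f_{\widetilde\lambda_q}\in C^0[0,\widetilde\lambda_q]$ is the unique solution of the integral equation $f(\xi)=q^*\big(\Phi(f)(\widetilde\lambda_q)-\Phi(f)(\xi)\big)$,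 $0\le\xi\le\widetilde\lambda_q$.
   Context: Data: positive constants $T_m,q,\rho_0,c_0,k_0,\ell$; $\alpha_0=k_0/(\rho_0c_0)$. The coefficients $k,\rho,c,\mu$ are real functions of temperature acting by composition, e.g. $k(T)(x,t)=k(T(x,t))$, and the convective speed is $v(T)=\mu(T)/\sqrt t$. Let $\mathscr C=C^0(\mathbb R_0^+\times\mathbb R^+)\cap L^\infty(\mathbb R_0^+\times\mathbb R^+)$ with the supremum norm $\|\cdot\|$. Hypotheses: there are positive constants $k_m,k_M,\widetilde k,\gamma_m,\gamma_M,\widetilde\gamma,\nu_m,\nu_M,\widetilde\nu$ such that for all $T,T_1,T_2\in\mathscr C$: (K) $k_m\le k(T)\le k_M$ and $\|k(T_1)-k(T_2)\|\le\widetilde k\|T_1-T_2\|$; (R) $\gamma_m\le\rho(T)c(T)\le\gamma_M$ and $\|\rho(T_1)c(T_1)-\rho(T_2)c(T_2)\|\le\widetilde\gamma\|T_1-T_2\|$; (V) $\nu_m\le\mu(T)\le\nu_M$ and $\|\mu(T_1)-\mu(T_2)\|\le\widetilde\nu\|T_1-T_2\|$. For a function $f$ of $\xi$ put $T=T_mf+T_m$ and $L^*(f)=k(T)/k_0$, $N^*(f)=\rho(T)c(T)/(\rho_0c_0)$, $\mu^*(f)=\mu(T)/\sqrt{\rho_0c_0k_0}$ (pointwise in $\xi$). Constants: $L_m=k_m/k_0$, $L_M=k_M/k_0$, $\widetilde L=\widetilde k|T_m|/k_0$, $N_m=\gamma_m/(\rho_0c_0)$, $N_M=\gamma_M/(\rho_0c_0)$,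 $\widetilde N=\widetilde\gamma|T_m|/(\rho_0c_0)$, $\mu_m=\nu_m/\sqrt{\rho_0c_0k_0}$, $\mu_M=\nu_M/\sqrt{\rho_0c_0k_0}$, $\widetilde\mu=\widetilde\nu|T_m|/\sqrt{\rho_0c_0k_0}$, $q^*=\frac{2q\sqrt{\alpha_0}}{k_0T_m}$, $M=\frac{2\ell k_0}{T_mc_0\,k(T_m)}$. For $f\in C^0[0,\lambda]$: $U(f)(z)=\exp\big(2\int_0^z\frac{\mu^*(f)(\sigma)}{L^*(f)(\sigma)}d\sigma\big)$, $I(f)(z)=\exp\big(2\int_0^z\frac{\sigma N^*(f)(\sigma)}{L^*(f)(\sigma)}d\sigma\big)$, $E(f)=U(f)/I(f)$, $\Phi(f)(\xi)=\int_0^\xi\frac{E(f)(z)}{L^*(f)(z)}dz$. Define, for $z\ge0$, $D_1(z)=\frac{2\exp(2\mu_Mz/L_m)}{L_m^2}z(\mu_M\widetilde L+L_m\widetilde\mu)$, $D_2(z)=\frac{\exp(N_Mz^2/L_m)}{L_m^2}z^2(N_M\widetilde L+L_m\widetilde N)$, $D_3(z)=\exp(\frac{N_M}{L_m}z^2)D_1(z)+\exp(2\frac{\mu_M}{L_m}z)D_2(z)$, $D_4(z)=\frac1{L_m^2}\big(\widetilde L\exp(2z\frac{\mu_M}{L_m})+L_mD_3(z)\big)$, and $\mathcal E_q(z)=2q^*zD_4(z)$. There is a unique $\overline\lambda_q>0$ with $\mathcal E_q(\overline\lambda_q)=1$, and for each $0<\lambda<\overline\lambda_q$ there is a unique $f_\lambda\in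 C^0[0,\lambda]$ with $f_\lambda(\xi)=q^*(\Phi(f_\lambda)(\lambda)-\Phi(f_\lambda)(\xi))$ on $[0,\lambda]$. Set $\mathcal V^q(\lambda)=\frac{q^*}{M\,L^*(f_\lambda)(\lambda)}E(f_\lambda)(\lambda)$ for $0<\lambda<\overline\lambda_q$. For $\lambda>0$: $\mathcal V_1^q(\lambda)=\frac{q^*}{ML_M}\exp(-\lambda^2\frac{N_M}{L_m})$ and $\mathcal V_2^q(\lambda)=\frac{q^*}{ML_m}\exp(2\lambda\frac{\mu_M}{L_m}-\lambda^2\frac{N_m}{L_M})$.
   Formalization: The open interval for λ̃_q becomes (λ_1q, λ_2q], with λ̃_q=λ_2q allowed only if k_m=k_M and μ(T)=ν_M, ρ(T)c(T)=γ_m along [0,λ̃_q]. For constant coefficients equal to their bounds V^q=V_2^q, so the open interval contains no solution. *)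

(* Defs.v *)
From Stdlib Require Import Reals.
From Coquelicot Require Import Coquelicot.
Open Scope R_scope.

(* The coefficients are real functions of temperature; [k(T)] is the
   composition [fun p => kT d (T p)]. *)
Record stefan_data := StefanData {
  Tm : R; q : R; rho0 : R; c0 : R; k0 : R; ell : R;
  kT : R -> R; rhoT : R -> R; cT : R -> R; muT : R -> R
}.

(* Lower bound, upper bound and Lipschitz constant of [k], [rho c] and [mu]. *)
Record stefan_bounds := StefanBounds {
  k_m : R; k_M : R; k_lip : R;
  gamma_m : R; gamma_M : R; gamma_lip : R;
  nu_m : R; nu_M : R; nu_lip : R
}.

Definition positive_data (d : stefan_data) : Prop :=
  0 < Tm d /\ 0 < q d /\ 0 < rho0 d /\ 0 < c0 d /\ 0 < k0 d /\ 0 < ell d.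

Definition positive_bounds (b : stefan_bounds) : Prop :=
  (0 < k_m b /\ 0 < k_M b /\ 0 < k_lip b) /\
  (0 < gamma_m b /\ 0 < gamma_M b /\ 0 < gamma_lip b) /\
  (0 < nu_m b /\ 0 < nu_M b /\ 0 < nu_lip b).

Definition alpha0 (d : stefan_data) : R := k0 d / (rho0 d * c0 d).

(* The space of bounded continuous temperatures on [0,+oo) x (0,+oo). Functions
   are total; only their values on the quarter plane are relevant. *)
Definition quarter_plane (p : R * R) : Prop := 0 <= fst p /\ 0 < snd p.

Definition in_C (T : R * R -> R) : Prop :=
  continuous_on quarter_plane T /\
  exists B : R, forall p, quarter_plane p -> Rabs (T p) <= B.

Definition sup_norm (T : R * R -> R) : Rbar :=
  Lub_Rbar (fun r => exists p, quarter_plane p /\ r = Rabs (T p)).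

Definition bounded_on_C (g : R -> R) (gm gM : R) : Prop :=
  forall T, in_C T -> forall p, quarter_plane p -> gm <= g (T p) <= gM.

Definition lipschitz_on_C (g : R -> R) (L : R) : Prop :=
  forall T1 T2, in_C T1 -> in_C T2 ->
    Rbar_le (sup_norm (fun p => g (T1 p) - g (T2 p)))
            (Rbar_mult (Finite L) (sup_norm (fun p => T1 p - T2 p))).

Definition hyp_K (d : stefan_data) (b : stefan_bounds) : Prop :=
  bounded_on_C (kT d) (k_m b) (k_M b) /\ lipschitz_on_C (kT d) (k_lip b).

Definition hyp_R (d : stefan_data) (b : stefan_bounds) : Prop :=
  bounded_on_C (fun r => rhoT d r * cT d r) (gamma_m b) (gamma_M b) /\
  lipschitz_on_C (fun r => rhoT d r * cT d r) (gamma_lip b).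

Definition hyp_V (d : stefan_data) (b : stefan_bounds) : Prop :=
  bounded_on_C (muT d) (nu_m b) (nu_M b) /\ lipschitz_on_C (muT d) (nu_lip b).

Definition T_of (d : stefan_data) (f : R -> R) (xi : R) : R :=
  Tm d * f xi + Tm d.

Definition Lstar (d : stefan_data) (f : R -> R) (xi : R) : R :=
  kT d (T_of d f xi) / k0 d.

Definition Nstar (d : stefan_data) (f : R -> R) (xi : R) : R :=
  rhoT d (T_of d f xi) * cT d (T_of d f xi) / (rho0 d * c0 d).

Definition mustar (d : stefan_data) (f : R -> R) (xi : R) : R :=
  muT d (T_of d f xi) / sqrt (rho0 d * c0 d * k0 d).

Definition L_m (d : stefan_data) (b : stefan_bounds) : R := k_m b / k0 d.
Definition L_M (d : stefan_data) (b : stefan_bounds) : R := k_M b / k0 d.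
Definition L_lip (d : stefan_data) (b : stefan_bounds) : R :=
  k_lip b * Rabs (Tm d) / k0 d.

Definition N_m (d : stefan_data) (b : stefan_bounds) : R :=
  gamma_m b / (rho0 d * c0 d).
Definition N_M (d : stefan_data) (b : stefan_bounds) : R :=
  gamma_M b / (rho0 d * c0 d).
Definition N_lip (d : stefan_data) (b : stefan_bounds) : R :=
  gamma_lip b * Rabs (Tm d) / (rho0 d * c0 d).

Definition mu_m (d : stefan_data) (b : stefan_bounds) : R :=
  nu_m b / sqrt (rho0 d * c0 d * k0 d).
Definition mu_M (d : stefan_data) (b : stefan_bounds) : R :=
  nu_M b / sqrt (rho0 d * c0 d * k0 d).
Definition mu_lip (d : stefan_data) (b : stefan_bounds) : R :=
  nu_lip b * Rabs (Tm d) / sqrt (rho0 d * c0 d * k0 d).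

Definition q_star (d : stefan_data) : R :=
  2 * q d * sqrt (alpha0 d) / (k0 d * Tm d).

Definition M_const (d : stefan_data) : R :=
  2 * ell d * k0 d / (Tm d * c0 d * kT d (Tm d)).

Definition U_fun (d : stefan_data) (f : R -> R) (z : R) : R :=
  exp (2 * RInt (fun sigma => mustar d f sigma / Lstar d f sigma) 0 z).

Definition I_fun (d : stefan_data) (f : R -> R) (z : R) : R :=
  exp (2 * RInt (fun sigma => sigma * Nstar d f sigma / Lstar d f sigma) 0 z).

Definition E_fun (d : stefan_data) (f : R -> R) (z : R) : R :=
  U_fun d f z / I_fun d f z.

Definition Phi (d : stefan_data) (f : R -> R) (xi : R) : R :=
  RInt (fun z => E_fun d f z / Lstar d f z) 0 xi.

Definition D1 (d : stefan_data) (b : stefan_bounds) (z : R) : R :=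
  2 * exp (2 * mu_M d b * z / L_m d b) / (L_m d b) ^ 2 * z *
  (mu_M d b * L_lip d b + L_m d b * mu_lip d b).

Definition D2 (d : stefan_data) (b : stefan_bounds) (z : R) : R :=
  exp (N_M d b * z ^ 2 / L_m d b) / (L_m d b) ^ 2 * z ^ 2 *
  (N_M d b * L_lip d b + L_m d b * N_lip d b).

Definition D3 (d : stefan_data) (b : stefan_bounds) (z : R) : R :=
  exp (N_M d b / L_m d b * z ^ 2) * D1 d b z +
  exp (2 * (mu_M d b / L_m d b) * z) * D2 d b z.

Definition D4 (d : stefan_data) (b : stefan_bounds) (z : R) : R :=
  1 / (L_m d b) ^ 2 *
  (L_lip d b * exp (2 * z * (mu_M d b / L_m d b)) + L_m d b * D3 d b z).

Definition E_q (d : stefan_data) (b : stefan_bounds) (z : R) : R :=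
  2 * q_star d * z * D4 d b z.

Definition V1 (d : stefan_data) (b : stefan_bounds) (lam : R) : R :=
  q_star d / (M_const d * L_M d b) *
  exp (- (lam ^ 2 * (N_M d b / L_m d b))).

Definition V2 (d : stefan_data) (b : stefan_bounds) (lam : R) : R :=
  q_star d / (M_const d * L_m d b) *
  exp (2 * lam * (mu_M d b / L_m d b) - lam ^ 2 * (N_m d b / L_M d b)).

(* An element of C^0[0,lam] is represented by a total function, of which only
   the restriction to [0,lam] matters; hence uniqueness is up to equality on
   [0,lam]. *)
Definition integral_solution (d : stefan_data) (lam : R) (f : R -> R) : Prop :=
  continuous_on (fun xi => 0 <= xi <= lam) f /\
  forall xi, 0 <= xi <= lam -> f xi = q_star d * (Phi d f lam - Phi d f xi).

Definition unique_integral_solution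
    (d : stefan_data) (lam : R) (f : R -> R) : Prop :=
  integral_solution d lam f /\
  forall g, integral_solution d lam g ->
    forall xi, 0 <= xi <= lam -> g xi = f xi.

(* [Vq d b lam v] is the graph of the function V^q: lam lies in its domain
   (0, lambda_bar_q) and [v] is its value there. *)
Definition Vq (d : stefan_data) (b : stefan_bounds) (lam v : R) : Prop :=
  (exists lam_bar : R,
     unique (fun z => 0 < z /\ E_q d b z = 1) lam_bar /\ 0 < lam < lam_bar) /\
  exists f : R -> R,
    unique_integral_solution d lam f /\
    v = q_star d / (M_const d * Lstar d f lam) * E_fun d f lam.

(* Derivative relative to a domain, so that it is one-sided at the endpoints of
   an interval ([is_derive] would look at values outside of it). *)
Definition is_derive_within
    (D : R -> Prop) (f : R -> R) (x l : R) : Prop :=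
  filterlim (fun y => (f y - f x) / (y - x))
            (within D (locally' x)) (locally l).

Definition velocity (d : stefan_data) (T t : R) : R := muT d T / sqrt t.

Definition stefan_solution
    (d : stefan_data) (T : R -> R -> R) (s : R -> R) : Prop :=
  s 0 = 0 /\
  exists Tx : R -> R -> R,
  forall t, 0 < t ->
    0 < s t /\
    (forall x, 0 <= x <= s t ->
       is_derive_within (fun y => 0 <= y <= s t)
                        (fun y => T y t) x (Tx x t)) /\
    (forall x, 0 < x < s t ->
       exists Tt flux_x : R,
         is_derive (fun t' => T x t') t Tt /\
         is_derive (fun x' => kT d (T x' t) * Tx x' t) x flux_x /\
         rhoT d (T x t) * cT d (T x t) * Tt =
           flux_x - velocity d (T x t) t * Tx x t) /\
    kT d (T 0 t) * Tx 0 t = - (q d / sqrt t) /\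
    T (s t) t = Tm d /\
    exists ds : R,
      is_derive s t ds /\
      kT d (T (s t) t) * Tx (s t) t = - (rho0 d * ell d * ds).

(* The coefficients realize the extreme values that enter V2, all along
   [0,lam]. Then V^q(lam) = V2(lam), so a fixed point of V2 is one of V^q. *)
Definition extremal_coefficients
    (d : stefan_data) (b : stefan_bounds) (lam : R) (f : R -> R) : Prop :=
  k_m b = k_M b /\
  forall xi, 0 <= xi <= lam ->
    muT d (T_of d f xi) = nu_M b /\
    rhoT d (T_of d f xi) * cT d (T_of d f xi) = gamma_m b.

(* Main.v *)
(* With [drift s r = mu^* / L^* - s N^* / L^*] evaluated at temperature [r], the function
   [E(f)(z)] is [exp (2 int_0^z drift s (f s) ds)] and the integral equation reads
   [f x = q^* int_x^lam E(f) / L^*(f)]. The condition [E_q < 1] makes the right-hand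
   side a contraction for every [lam <= lam2]. The contraction estimate applied to
   solutions with endpoints [l1 < l2], on [0,l1], gives uniqueness and makes
   [lam |-> V^q(lam)] Lipschitz. Since [V1 < V^q <= V2], the intermediate value
   theorem on [lam1,lam2] yields a fixed point of [V^q] in (lam1,lam2]; a fixed
   point at [lam2] is an equality case of the bound on the integral of [drift],
   which forces the coefficients to be extremal. Finally, [E(f)] is differentiable
   with logarithmic derivative [2 drift], which is the heat equation in the
   similarity variable, and [V^q(lam) = lam] is the Stefan condition. *)
Require Import Defs.
From Stdlib Require Import Reals Lra Lia.
From Coquelicot Require Import Coquelicot.
Open Scope R_scope.

(** * Elementary estimates: continuity, integrals, [exp], truncation and geometric convergence *)

Lemma continuous_ex_RInt (f : R -> R) (a b : R) :
  (forall x, continuous f x) -> ex_RInt f a b.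
Proof. intros Hf; apply (ex_RInt_continuous f); auto. Qed.

Lemma lipschitz_continuous (K : R) (f : R -> R) :
  (forall x y, Rabs (f x - f y) <= K * Rabs (x - y)) ->
  forall x, continuous f x.
Proof.
intros HK x.
assert (HK0 : 0 <= K).
{ specialize (HK 1 0); rewrite Rminus_0_r, Rabs_R1 in HK.
  pose proof (Rabs_pos (f 1 - f 0)); lra. }
apply continuity_pt_filterlim; intros eps Heps.
(* [K] may be [0], hence the denominator [K + 1]. *)
exists (eps / (K + 1)); split.
{ apply Rdiv_lt_0_compat; lra. }
intros y [_ Hy]; simpl in *; unfold R_dist in *.
apply Rle_lt_trans with (1 := HK y x).
apply Rmult_lt_compat_r with (r := K + 1) in Hy; [|lra].
unfold Rdiv in Hy; rewrite Rmult_assoc, Rinv_l in Hy by lra.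
pose proof (Rabs_pos (y - x)); nra.
Qed.

Lemma is_derive_RInt_upper (f : R -> R) (a x : R) :
  (forall y, continuous f y) -> is_derive (fun y => RInt f a y) x (f x).
Proof.
intros Hf; apply (is_derive_RInt f (fun y => RInt f a y) a); auto.
apply filter_forall; intros y; apply (RInt_correct f).
now apply continuous_ex_RInt.
Qed.

Lemma is_derive_RInt_lower (f : R -> R) (b x : R) :
  (forall y, continuous f y) -> is_derive (fun y => RInt f y b) x (- f x).
Proof.
intros Hf; apply (is_derive_RInt' f (fun y => RInt f y b) x b); auto.
apply filter_forall; intros y; apply (RInt_correct f).
now apply continuous_ex_RInt.
Qed.

Lemma abs_RInt_le_bound (f : R -> R) (a b M : R) :
  (forall x, continuous f x) ->
  (forall x, Rmin a b <= x <= Rmax a b -> Rabs (f x) <= M) ->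
  Rabs (RInt f a b) <= M * Rabs (b - a).
Proof.
intros Hf HM; rewrite Rmult_comm.
apply (norm_RInt_le_const_abs f a b (RInt f a b) M HM).
apply (RInt_correct f); now apply continuous_ex_RInt.
Qed.

Lemma RInt_split (f : R -> R) (a b c : R) :
  (forall x, continuous f x) -> RInt f a c = RInt f a b + RInt f b c.
Proof.
intros Hf; symmetry; apply (RInt_Chasles f); now apply continuous_ex_RInt.
Qed.

Lemma RInt_sub (f g : R -> R) (a b : R) :
  (forall x, continuous f x) -> (forall x, continuous g x) ->
  RInt f a b - RInt g a b = RInt (fun x => f x - g x) a b.
Proof.
intros Hf Hg; symmetry; apply (RInt_minus f g); now apply continuous_ex_RInt.
Qed.

Lemma exp_le (x y : R) : x <= y -> exp x <= exp y.
Proof.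
intros [H| ->]; [left; now apply exp_increasing | apply Rle_refl].
Qed.

Lemma exp_diff_le (c x y : R) :
  x <= c -> y <= c -> Rabs (exp x - exp y) <= exp c * Rabs (x - y).
Proof.
assert (Hle : forall u v, u <= v -> v <= c ->
  Rabs (exp u - exp v) <= exp c * Rabs (u - v)).
{ intros u v Huv Hv.
  (* Factoring out [exp v] leaves [1 - exp (u - v)], which the tangent inequality [1 + x <= exp x]
     bounds by [v - u]. *)
  assert (E : exp u = exp v * exp (u - v)) by (rewrite <- exp_plus; f_equal; ring).
  pose proof (exp_pos v).
  assert (exp v <= exp c) by now apply exp_le.
  pose proof (exp_ineq1_le (u - v)).
  assert (exp (u - v) <= 1) by (rewrite <- exp_0; apply exp_le; lra).
  rewrite !Rabs_left1 by nra; nra. }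
intros Hx Hy; destruct (Rle_dec x y) as [H|H].
- now apply Hle.
- rewrite (Rabs_minus_sym (exp x)), (Rabs_minus_sym x); apply Hle; lra.
Qed.

(** The retraction of the line onto [[a,b]]. Composing with it extends a continuous function on
    [[a,b]] to a globally continuous one, so the lemmas on integrals can assume continuity
    everywhere. *)
Definition clamp (a b x : R) : R := Rmax a (Rmin b x).

Lemma clamp_range (a b x : R) : a <= b -> a <= clamp a b x <= b.
Proof.
intros; unfold clamp, Rmax, Rmin.
repeat destruct (Rle_dec _ _); lra.
Qed.

Lemma clamp_id (a b x : R) : a <= x <= b -> clamp a b x = x.
Proof.
intros; unfold clamp, Rmax, Rmin.
repeat destruct (Rle_dec _ _); lra.
Qed.

Lemma clamp_lipschitz (a b x y : R) :
  Rabs (clamp a b x - clamp a b y) <= Rabs (x - y).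
Proof.
unfold clamp, Rmax, Rmin, Rabs.
repeat destruct (Rle_dec _ _); repeat destruct (Rcase_abs _); lra.
Qed.

Lemma continuous_on_clamp (a b : R) (f : R -> R) :
  a <= b -> continuous_on (fun x => a <= x <= b) f ->
  forall x, continuous (fun y => f (clamp a b y)) x.
Proof.
intros Hab Hf x.
apply filterlim_comp with (2 := Hf (clamp a b x) (clamp_range a b x Hab)).
intros S HS.
assert (Hc : continuous (clamp a b) x).
{ apply (lipschitz_continuous 1); intros u v; rewrite Rmult_1_l.
  apply clamp_lipschitz. }
specialize (Hc _ HS); unfold filtermap in *.
apply filter_imp with (2 := Hc); intros y Hy.
now apply Hy, clamp_range.
Qed.

(** The limit is named by [Lim_seq], so that the limit of the Picard iterates is a plain definition.
    The second conclusion is a rate that is uniform in every parameter on which [A] and [k] do not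
    depend. *)
Lemma geometric_cauchy_limit (u : nat -> R) (A k : R) :
  0 <= k < 1 -> (forall n, Rabs (u (S n) - u n) <= A * k ^ n) ->
  is_lim_seq u (real (Lim_seq u)) /\
  forall n, Rabs (u n - real (Lim_seq u)) <= A / (1 - k) * k ^ n.
Proof.
intros Hk Hu.
assert (HA : 0 <= A).
{ specialize (Hu O); simpl in Hu; pose proof (Rabs_pos (u 1%nat - u O)); lra. }
assert (HA' : 0 <= A / (1 - k)) by (apply Rdiv_le_0_compat; lra).
assert (Hkn : forall n, 0 <= k ^ n) by (intros; apply pow_le; lra).
(* The geometric sum is kept in closed form, since its weakening [A / (1 - k) * k ^ n] would not
   carry through the induction. *)
assert (Hp : forall n p, Rabs (u (n + p)%nat - u n) <= A / (1 - k) * (k ^ n - k ^ (n + p))).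
{ intros n; induction p as [|p IH].
  - rewrite Nat.add_0_r, !Rminus_diag, Rabs_R0, Rmult_0_r; lra.
  - rewrite Nat.add_succ_r.
    replace (u (S (n + p)) - u n) with
      ((u (S (n + p)) - u (n + p)%nat) + (u (n + p)%nat - u n)) by ring.
    eapply Rle_trans; [apply Rabs_triang|].
    specialize (Hu (n + p)%nat).
    replace (A / (1 - k) * (k ^ n - k ^ S (n + p))) with
      (A * k ^ (n + p) + A / (1 - k) * (k ^ n - k ^ (n + p)))
      by (simpl; field; lra).
    lra. }
assert (Hnm : forall n m, (n <= m)%nat -> Rabs (u m - u n) <= A / (1 - k) * k ^ n).
{ intros n m Hnm; replace m with (n + (m - n))%nat by lia.
  eapply Rle_trans; [apply Hp|].
  apply Rmult_le_compat_l; trivial.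
  specialize (Hkn (n + (m - n))%nat); lra. }
assert (H0 : is_lim_seq (fun n => A / (1 - k) * k ^ n) 0).
{ replace (Finite 0) with (Rbar_mult (A / (1 - k)) 0) by (simpl; f_equal; ring).
  apply is_lim_seq_scal_l, is_lim_seq_geom; rewrite Rabs_pos_eq; lra. }
assert (Hex : ex_finite_lim_seq u).
{ apply ex_lim_seq_cauchy_corr; intros eps.
  apply is_lim_seq_spec in H0; destruct (H0 eps) as [N HN].
  assert (Hb : forall n m, (N <= n)%nat -> (n <= m)%nat -> Rabs (u m - u n) < eps).
  { intros n m Hn Hm; apply Rle_lt_trans with (1 := Hnm n m Hm).
    specialize (HN n Hn); rewrite Rminus_0_r in HN.
    apply Rle_lt_trans with (2 := HN), Rle_abs. }
  exists N; intros n m Hn Hm; destruct (Nat.le_ge_cases n m).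
  - rewrite Rabs_minus_sym; auto.
  - auto. }
apply Lim_seq_correct' in Hex; split; trivial.
intros n.
apply (is_lim_seq_le_loc (fun m => Rabs (u n - u m)) (fun _ => A / (1 - k) * k ^ n)
  (Rabs (u n - Lim_seq u)) (A / (1 - k) * k ^ n)).
- exists n; intros m Hm; rewrite Rabs_minus_sym; auto.
- apply (is_lim_seq_abs _ (u n - Lim_seq u)).
  apply is_lim_seq_minus'; trivial; apply is_lim_seq_const.
- apply is_lim_seq_const.
Qed.

(** * The integral equation *)

Section IntegralEquation.

(** [h] abstracts [drift], [g] abstracts [resistivity] and [qs] is [q^*]. Two bounds on [h] are kept
    apart: the one-sided bound [P] enters the contraction constant through [exp], whereas [Q] enters
    only the Lipschitz estimate in the endpoint. *)
Variables (h : R -> R -> R) (g : R -> R) (qs Lam P Q H G K : R).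
Hypotheses (qs_ge0 : 0 <= qs) (Lam_ge0 : 0 <= Lam).
Hypothesis h_cont : forall f : R -> R, (forall x, continuous f x) ->
  forall s, continuous (fun s => h s (f s)) s.
Hypothesis h_le : forall s r, 0 <= s <= Lam -> h s r <= P.
Hypothesis h_abs : forall s r, 0 <= s <= Lam -> Rabs (h s r) <= Q.
Hypothesis h_lip : forall s r r', 0 <= s <= Lam ->
  Rabs (h s r - h s r') <= H * Rabs (r - r').
Hypothesis g_range : forall r, 0 <= g r <= G.
Hypothesis g_lip : forall r r', Rabs (g r - g r') <= K * Rabs (r - r').

(** This is [E(f)]; [kernel] is then the integrand of [Phi(f)]. *)
Definition growth (f : R -> R) (z : R) : R :=
  exp (2 * RInt (fun s => h s (f s)) 0 z).

Definition kernel (f : R -> R) (z : R) : R := growth f z * g (f z).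

(** [B] bounds [growth] on [[0,Lam]], and [C] is a Lipschitz constant of [f |-> kernel f] for the
    supremum norm. Integration over an interval of length at most [Lam] turns it into the
    contraction factor [qs * Lam * C]. *)
Let B := exp (2 * P * Lam).
Let C := B * (K + 2 * Lam * H * G).

Hypothesis P_ge0 : 0 <= P.
Hypothesis contraction : qs * Lam * C < 1.

Lemma H_ge0 : 0 <= H.
Proof.
assert (Hs : 0 <= 0 <= Lam) by lra.
pose proof (h_lip 0 1 0 Hs) as Hh; rewrite Rminus_0_r, Rabs_R1 in Hh.
pose proof (Rabs_pos (h 0 1 - h 0 0)); lra.
Qed.

Lemma K_ge0 : 0 <= K.
Proof.
pose proof (g_lip 1 0) as Hh; rewrite Rminus_0_r, Rabs_R1 in Hh.
pose proof (Rabs_pos (g 1 - g 0)); lra.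
Qed.

Lemma G_ge0 : 0 <= G.
Proof. pose proof (g_range 0); lra. Qed.

Lemma C_ge0 : 0 <= C.
Proof.
pose proof (exp_pos (2 * P * Lam)); pose proof K_ge0; pose proof H_ge0.
pose proof G_ge0; unfold C, B.
apply Rmult_le_pos; [lra|]; apply Rplus_le_le_0_compat; trivial.
repeat apply Rmult_le_pos; lra.
Qed.

Lemma BG_ge0 : 0 <= B * G.
Proof.
apply Rmult_le_pos; [left; apply exp_pos | apply G_ge0].
Qed.

Lemma growth_exponent_le (f : R -> R) (z : R) :
  (forall x, continuous f x) -> 0 <= z <= Lam ->
  2 * RInt (fun s => h s (f s)) 0 z <= 2 * P * Lam.
Proof.
intros Hf Hz.
assert (RInt (fun s => h s (f s)) 0 z <= RInt (fun _ => P) 0 z).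
{ apply RInt_le; try lra; try (now apply continuous_ex_RInt, h_cont).
  - apply ex_RInt_const.
  - intros; apply h_le; lra. }
rewrite RInt_const in H0; unfold scal in H0; simpl in H0; unfold mult in H0; simpl in H0.
nra.
Qed.

Lemma growth_le (f : R -> R) (z : R) :
  (forall x, continuous f x) -> 0 <= z <= Lam -> growth f z <= B.
Proof.
intros Hf Hz; apply exp_le; now apply growth_exponent_le.
Qed.

Lemma growth_derive (f : R -> R) (z : R) :
  (forall x, continuous f x) ->
  is_derive (growth f) z (2 * h z (f z) * growth f z).
Proof.
intros Hf.
apply (is_derive_comp exp (fun z => 2 * RInt (fun s => h s (f s)) 0 z)).
- apply is_derive_Reals, derivable_pt_lim_exp.
- apply (is_derive_scal (fun z => RInt (fun s => h s (f s)) 0 z)).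
  apply (is_derive_RInt_upper (fun s => h s (f s))).
  now apply h_cont.
Qed.

Lemma g_cont : forall r, continuous g r.
Proof. apply (lipschitz_continuous K), g_lip. Qed.

Lemma growth_cont (f : R -> R) :
  (forall x, continuous f x) -> forall z, continuous (growth f) z.
Proof.
intros Hf z; apply (ex_derive_continuous (growth f)).
eexists; now apply growth_derive.
Qed.

Lemma kernel_cont (f : R -> R) :
  (forall x, continuous f x) -> forall z, continuous (kernel f) z.
Proof.
intros Hf z; apply (continuous_mult (growth f) (fun z => g (f z))).
- now apply growth_cont.
- apply continuous_comp; [apply Hf | apply g_cont].
Qed.

Lemma kernel_abs_le (f : R -> R) (z : R) :
  (forall x, continuous f x) -> 0 <= z <= Lam -> Rabs (kernel f z) <= B * G.
Proof.
intros Hf Hz; pose proof (growth_le f z Hf Hz); unfold kernel.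
assert (0 < growth f z) by apply exp_pos.
pose proof (g_range (f z)).
rewrite Rabs_pos_eq; [apply Rmult_le_compat; lra | apply Rmult_le_pos; lra].
Qed.

Lemma growth_lipschitz (f : R -> R) (z z' : R) :
  (forall x, continuous f x) -> 0 <= z <= Lam -> 0 <= z' <= Lam ->
  Rabs (growth f z - growth f z') <= B * (2 * Q) * Rabs (z - z').
Proof.
intros Hf Hz Hz'.
eapply Rle_trans.
{ apply exp_diff_le; apply growth_exponent_le; eassumption. }
fold B; rewrite (Rmult_assoc B); apply Rmult_le_compat_l; [left; apply exp_pos|].
rewrite (RInt_split _ 0 z' z) by now apply h_cont.
match goal with |- Rabs ?e <= _ =>
  replace e with (2 * RInt (fun s => h s (f s)) z' z) by ring end.
rewrite Rabs_mult, Rabs_pos_eq, Rmult_assoc by lra.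
apply Rmult_le_compat_l; [lra|].
apply abs_RInt_le_bound; [now apply h_cont|].
intros x Hx; apply h_abs.
revert Hx; unfold Rmin, Rmax; destruct Rle_dec; lra.
Qed.

(** Only the values of [f1] and [f2] on [[0,z]] are compared, which is what makes solutions with
    different endpoints comparable. *)
Lemma growth_diff (f1 f2 : R -> R) (z delta : R) :
  (forall x, continuous f1 x) -> (forall x, continuous f2 x) ->
  0 <= z <= Lam ->
  (forall x, 0 <= x <= z -> Rabs (f1 x - f2 x) <= delta) ->
  Rabs (growth f1 z - growth f2 z) <= B * (2 * Lam * H) * delta.
Proof.
intros Hf1 Hf2 Hz Hd.
assert (Hd0 : 0 <= delta).
{ eapply Rle_trans; [apply Rabs_pos | apply (Hd z); lra]. }
eapply Rle_trans.
{ apply exp_diff_le; apply growth_exponent_le; eassumption. }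
fold B; rewrite (Rmult_assoc B); apply Rmult_le_compat_l; [left; apply exp_pos|].
rewrite <- Rmult_minus_distr_l, RInt_sub by now apply h_cont.
rewrite Rabs_mult, Rabs_pos_eq, !Rmult_assoc by lra.
apply Rmult_le_compat_l; [lra|].
apply Rle_trans with (H * delta * Rabs (z - 0)).
- apply abs_RInt_le_bound.
  + intros x; apply (continuous_minus (fun s => h s (f1 s)) (fun s => h s (f2 s)));
      now apply h_cont.
  + rewrite Rmin_left, Rmax_right by lra; intros x Hx.
    eapply Rle_trans; [apply h_lip; lra|].
    apply Rmult_le_compat_l; [apply H_ge0 | auto].
- rewrite Rminus_0_r, Rabs_pos_eq, (Rmult_comm Lam) by lra.
  apply Rmult_le_compat_l; [|lra].
  apply Rmult_le_pos; [apply H_ge0 | trivial].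
Qed.

Lemma kernel_diff (f1 f2 : R -> R) (z delta : R) :
  (forall x, continuous f1 x) -> (forall x, continuous f2 x) ->
  0 <= z <= Lam ->
  (forall x, 0 <= x <= z -> Rabs (f1 x - f2 x) <= delta) ->
  Rabs (kernel f1 z - kernel f2 z) <= C * delta.
Proof.
intros Hf1 Hf2 Hz Hd; unfold kernel.
pose proof (growth_diff f1 f2 z delta Hf1 Hf2 Hz Hd) as Hg.
pose proof (growth_le f1 z Hf1 Hz).
assert (0 < growth f1 z) by apply exp_pos.
(* The first difference costs [B * K], the second [B * (2 * Lam * H) * G]; these constants add up to
   [C]. *)
replace (growth f1 z * g (f1 z) - growth f2 z * g (f2 z)) with
  (growth f1 z * (g (f1 z) - g (f2 z)) + (growth f1 z - growth f2 z) * g (f2 z))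
  by ring.
eapply Rle_trans; [apply Rabs_triang|].
rewrite !Rabs_mult, (Rabs_pos_eq (growth f1 z)), (Rabs_pos_eq (g (f2 z)))
  by (try apply g_range; lra).
replace (C * delta) with (B * (K * delta) + B * (2 * Lam * H) * delta * G)
  by (unfold C; ring).
pose proof (g_range (f2 z)); pose proof (Rabs_pos (growth f1 z - growth f2 z)).
apply Rplus_le_compat.
- apply Rmult_le_compat; try lra; try apply Rabs_pos.
  eapply Rle_trans; [apply g_lip|].
  apply Rmult_le_compat_l; [apply K_ge0 | apply Hd; lra].
- apply Rmult_le_compat; lra.
Qed.

Definition solves (lam : R) (f : R -> R) : Prop :=
  forall x, 0 <= x <= lam -> f x = qs * RInt (kernel f) x lam.

(* Two solutions with different endpoints are compared on the shorter interval;
   [l1 = l2] gives uniqueness. *)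
Lemma solves_compare (l1 l2 : R) (f1 f2 : R -> R) :
  (forall x, continuous f1 x) -> (forall x, continuous f2 x) ->
  0 <= l1 <= l2 -> l2 <= Lam -> solves l1 f1 -> solves l2 f2 ->
  forall x, 0 <= x <= l1 ->
  Rabs (f1 x - f2 x) <= qs * (B * G) / (1 - qs * Lam * C) * (l2 - l1).
Proof.
intros Hf1 Hf2 Hl1 Hl2 Hs1 Hs2.
(* The largest gap on [[0,l1]] is attained at some [m]. Writing both equations at [m] bounds the gap
   by [qs * Lam * C < 1] times itself plus a remainder, and the first term is absorbed. *)
destruct (continuity_ab_maj (fun x => Rabs (f1 x - f2 x)) 0 l1) as [m [Hm Hm01]].
{ lra. }
{ intros c _; apply continuity_pt_filterlim.
  apply (continuous_comp (fun x => f1 x - f2 x) Rabs).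
  - now apply (continuous_minus f1 f2).
  - apply continuous_Rabs. }
intros x Hx; apply Rle_trans with (1 := Hm x Hx).
set (delta := Rabs (f1 m - f2 m)) in *.
assert (Hc1 := kernel_cont f1 Hf1); assert (Hc2 := kernel_cont f2 Hf2).
assert (Hd0 : 0 <= delta) by apply Rabs_pos.
assert (Hmain : delta <= qs * (C * delta * Lam + B * G * (l2 - l1))).
{ unfold delta at 1; rewrite (Hs1 m), (Hs2 m) by lra.
  (* The piece over [[l1,l2]] belongs to [f2] alone; it is the source of the term in [l2 - l1]. *)
  rewrite (RInt_split _ m l1 l2) by trivial.
  match goal with |- Rabs ?e <= _ => replace e with
   (qs * ((RInt (kernel f1) m l1 - RInt (kernel f2) m l1) - RInt (kernel f2) l1 l2))
   by ring end.
  rewrite Rabs_mult, (Rabs_pos_eq qs) by lra.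
  apply Rmult_le_compat_l; trivial.
  eapply Rle_trans; [apply Rabs_triang|]; rewrite Rabs_Ropp.
  apply Rplus_le_compat.
  - rewrite RInt_sub by trivial.
    apply Rle_trans with (C * delta * Rabs (l1 - m)).
    + apply abs_RInt_le_bound.
      * intros y; now apply (continuous_minus (kernel f1) (kernel f2)).
      * rewrite Rmin_left, Rmax_right by lra; intros y Hy.
        apply kernel_diff; auto; try lra.
        intros z Hz; apply Hm; lra.
    + rewrite Rabs_pos_eq by lra; apply Rmult_le_compat_l; [|lra].
      apply Rmult_le_pos; [apply C_ge0 | trivial].
  - apply Rle_trans with (B * G * Rabs (l2 - l1)).
    + apply abs_RInt_le_bound; trivial.
      rewrite Rmin_left, Rmax_right by lra; intros y Hy.
      apply kernel_abs_le; trivial; lra.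
    + rewrite Rabs_pos_eq; lra. }
apply Rmult_le_reg_l with (1 - qs * Lam * C); [lra|].
replace ((1 - qs * Lam * C) * (qs * (B * G) / (1 - qs * Lam * C) * (l2 - l1)))
  with (qs * (B * G) * (l2 - l1)) by (field; lra).
lra.
Qed.

Lemma solves_unique (lam : R) (f1 f2 : R -> R) :
  (forall x, continuous f1 x) -> (forall x, continuous f2 x) ->
  0 <= lam <= Lam -> solves lam f1 -> solves lam f2 ->
  forall x, 0 <= x <= lam -> f1 x = f2 x.
Proof.
intros Hf1 Hf2 Hlam Hs1 Hs2 x Hx.
assert (Hcmp := solves_compare lam lam f1 f2 Hf1 Hf2).
rewrite Rminus_diag, Rmult_0_r in Hcmp.
apply Rminus_diag_uniq, Rabs_eq_0, Rle_antisym; [|apply Rabs_pos].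
apply Hcmp; trivial; lra.
Qed.

(** Clamping makes every image constant on each side of [[0,lam]] and Lipschitz on the whole line,
    so iterates can be compared at all real points. *)
Definition integral_map (lam : R) (f : R -> R) (x : R) : R :=
  qs * RInt (kernel f) (clamp 0 lam x) lam.

Fixpoint picard (lam : R) (n : nat) : R -> R :=
  match n with
  | O => fun _ => 0
  | S n => integral_map lam (picard lam n)
  end.

Definition picard_limit (lam : R) (x : R) : R :=
  real (Lim_seq (fun n => picard lam n x)).

Lemma integral_map_lipschitz (lam : R) (f : R -> R) (x y : R) :
  (forall x, continuous f x) -> 0 <= lam <= Lam ->
  Rabs (integral_map lam f x - integral_map lam f y) <= qs * (B * G) * Rabs (x - y).
Proof.
intros Hf Hlam; unfold integral_map.
pose proof (clamp_range 0 lam x (proj1 Hlam)).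
pose proof (clamp_range 0 lam y (proj1 Hlam)).
pose proof (clamp_lipschitz 0 lam y x) as Hc.
rewrite (RInt_split _ (clamp 0 lam x) (clamp 0 lam y) lam) by now apply kernel_cont.
match goal with |- Rabs ?e <= _ => replace e with
  (qs * RInt (kernel f) (clamp 0 lam x) (clamp 0 lam y)) by ring end.
rewrite Rabs_mult, Rabs_pos_eq, Rmult_assoc by lra.
apply Rmult_le_compat_l; trivial.
apply Rle_trans with (B * G * Rabs (clamp 0 lam y - clamp 0 lam x)).
- apply abs_RInt_le_bound; [now apply kernel_cont|].
  intros z Hz; apply kernel_abs_le; trivial.
  revert Hz; unfold Rmin, Rmax; destruct Rle_dec; lra.
- rewrite (Rabs_minus_sym x); apply Rmult_le_compat_l; [apply BG_ge0 | trivial].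
Qed.

Lemma integral_map_diff (lam delta : R) (f1 f2 : R -> R) (x : R) :
  (forall x, continuous f1 x) -> (forall x, continuous f2 x) ->
  0 <= lam <= Lam -> (forall x, Rabs (f1 x - f2 x) <= delta) ->
  Rabs (integral_map lam f1 x - integral_map lam f2 x) <= qs * Lam * C * delta.
Proof.
intros Hf1 Hf2 Hlam Hd; unfold integral_map.
pose proof (clamp_range 0 lam x (proj1 Hlam)) as Hx.
rewrite <- Rmult_minus_distr_l, RInt_sub by now apply kernel_cont.
rewrite Rabs_mult, Rabs_pos_eq, !Rmult_assoc by lra.
apply Rmult_le_compat_l; trivial.
assert (0 <= C * delta).
{ apply Rmult_le_pos; [apply C_ge0|].
  apply Rle_trans with (2 := Hd 0), Rabs_pos. }
apply Rle_trans with (C * delta * Rabs (lam - clamp 0 lam x)).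
- apply abs_RInt_le_bound.
  + intros y; apply (continuous_minus (kernel f1) (kernel f2)); now apply kernel_cont.
  + rewrite Rmin_left, Rmax_right by lra; intros y Hy.
    apply kernel_diff; auto; lra.
- rewrite Rabs_pos_eq, (Rmult_comm Lam) by lra; apply Rmult_le_compat_l; lra.
Qed.

Lemma picard_cont (lam : R) (n : nat) :
  0 <= lam <= Lam -> forall x, continuous (picard lam n) x.
Proof.
intros Hlam; induction n as [|n IH].
- intros x; apply continuous_const.
- apply (lipschitz_continuous (qs * (B * G))); intros x y.
  now apply integral_map_lipschitz.
Qed.

Lemma picard_step (lam : R) (n : nat) (x : R) :
  0 <= lam <= Lam ->
  Rabs (picard lam (S n) x - picard lam n x) <= qs * (B * G) * Lam * (qs * Lam * C) ^ n.
Proof.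
intros Hlam; revert x; induction n as [|n IH]; intros x.
- pose proof (clamp_range 0 lam x (proj1 Hlam)).
  simpl picard; rewrite Rminus_0_r, pow_O, Rmult_1_r; unfold integral_map.
  rewrite Rabs_mult, Rabs_pos_eq, Rmult_assoc by lra.
  apply Rmult_le_compat_l; trivial.
  apply Rle_trans with (B * G * Rabs (lam - clamp 0 lam x)).
  + apply abs_RInt_le_bound.
    * apply kernel_cont; intros; apply continuous_const.
    * rewrite Rmin_left, Rmax_right by lra; intros y Hy.
      apply kernel_abs_le; [intros; apply continuous_const | lra].
  + rewrite Rabs_pos_eq by lra.
    apply Rmult_le_compat_l; [apply BG_ge0 | lra].
- eapply Rle_trans.
  { apply (integral_map_diff lam (qs * (B * G) * Lam * (qs * Lam * C) ^ n)
      (picard lam (S n)) (picard lam n));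
      [now apply picard_cont | now apply picard_cont | trivial | apply IH]. }
  simpl; lra.
Qed.

Lemma contraction_range : 0 <= qs * Lam * C < 1.
Proof.
split; trivial; apply Rmult_le_pos; [now apply Rmult_le_pos | apply C_ge0].
Qed.

Lemma picard_limit_spec (lam x : R) :
  0 <= lam <= Lam ->
  is_lim_seq (fun n => picard lam n x) (picard_limit lam x) /\
  forall n, Rabs (picard lam n x - picard_limit lam x) <=
    qs * (B * G) * Lam / (1 - qs * Lam * C) * (qs * Lam * C) ^ n.
Proof.
intros Hlam; apply (geometric_cauchy_limit (fun n => picard lam n x)).
- apply contraction_range.
- intros n; now apply picard_step.
Qed.

(** All images under [integral_map] share one Lipschitz constant, and such a bound survives a
    pointwise limit. *)
Lemma picard_limit_cont (lam : R) :
  0 <= lam <= Lam -> forall x, continuous (picard_limit lam) x.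
Proof.
intros Hlam; apply (lipschitz_continuous (qs * (B * G))); intros x y.
apply (is_lim_seq_le_loc (fun n => Rabs (picard lam n x - picard lam n y))
  (fun _ => qs * (B * G) * Rabs (x - y))
  (Rabs (picard_limit lam x - picard_limit lam y)) (qs * (B * G) * Rabs (x - y))).
(* Index [0] is skipped because only successors are images of [integral_map]. *)
- exists 1%nat; intros [|n] Hn; [lia|].
  apply integral_map_lipschitz; [now apply picard_cont | trivial].
- apply (is_lim_seq_abs _ (picard_limit lam x - picard_limit lam y)).
  apply is_lim_seq_minus'; now apply picard_limit_spec.
- apply is_lim_seq_const.
Qed.

(** The iterates of successor index converge to both sides: to the right one as a shifted sequence,
    to the left one because [integral_map_diff] transfers the uniform rate of
    [picard_limit_spec]. *)
Lemma picard_limit_fixed (lam x : R) :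
  0 <= lam <= Lam -> integral_map lam (picard_limit lam) x = picard_limit lam x.
Proof.
intros Hlam.
destruct (picard_limit_spec lam x Hlam) as [Hl _].
apply is_lim_seq_incr_1 in Hl.
assert (Hl' : is_lim_seq (fun n => picard lam (S n) x)
  (integral_map lam (picard_limit lam) x)).
{ apply is_lim_seq_ext with
    (fun n => (picard lam (S n) x - integral_map lam (picard_limit lam) x) +
              integral_map lam (picard_limit lam) x).
  { intros; ring. }
  rewrite <- (Rplus_0_l (integral_map _ _ _)) at 1.
  apply is_lim_seq_plus'; [|apply is_lim_seq_const].
  apply is_lim_seq_abs_0.
  set (k := qs * Lam * C) in *.
  apply is_lim_seq_le_le with (fun _ => 0)
    (fun n => k * (qs * (B * G) * Lam / (1 - k)) * k ^ n).
  - intros n; split; [apply Rabs_pos|].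
    rewrite Rmult_assoc; apply integral_map_diff; trivial.
    + now apply picard_cont.
    + now apply picard_limit_cont.
    + intros y; now apply picard_limit_spec.
  - apply is_lim_seq_const.
  - replace (Finite 0) with
      (Rbar_mult (k * (qs * (B * G) * Lam / (1 - k))) 0) by (simpl; f_equal; ring).
    pose proof contraction_range.
    apply is_lim_seq_scal_l, is_lim_seq_geom; rewrite Rabs_pos_eq; unfold k; lra. }
apply is_lim_seq_unique in Hl; apply is_lim_seq_unique in Hl'.
rewrite Hl in Hl'; injection Hl'; auto.
Qed.

Lemma picard_limit_solves (lam : R) :
  0 <= lam <= Lam -> solves lam (picard_limit lam).
Proof.
intros Hlam x Hx; rewrite <- picard_limit_fixed by trivial.
unfold integral_map; now rewrite clamp_id.
Qed.

(** Moving the endpoint changes both the solution and the point of evaluation. For [l1 <= l2] the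
    two effects are separated by inserting the solution for [l2] evaluated at [l1]. The continuity
    of [V^q] comes from here. *)
Lemma endpoint_growth_lipschitz :
  exists D, forall l1 l2, 0 <= l1 <= Lam -> 0 <= l2 <= Lam ->
  Rabs (growth (picard_limit l1) l1 - growth (picard_limit l2) l2) <=
  D * Rabs (l1 - l2).
Proof.
exists (B * (2 * Lam * H) * (qs * (B * G) / (1 - qs * Lam * C)) + B * (2 * Q)).
assert (Hle : forall l1 l2, 0 <= l1 <= l2 -> l2 <= Lam ->
  Rabs (growth (picard_limit l1) l1 - growth (picard_limit l2) l2) <=
  (B * (2 * Lam * H) * (qs * (B * G) / (1 - qs * Lam * C)) + B * (2 * Q)) *
  Rabs (l1 - l2)).
{ intros l1 l2 H1 H2.
  assert (Hc1 : forall x, continuous (picard_limit l1) x)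
    by (apply picard_limit_cont; lra).
  assert (Hc2 : forall x, continuous (picard_limit l2) x)
    by (apply picard_limit_cont; lra).
  replace (growth (picard_limit l1) l1 - growth (picard_limit l2) l2) with
    ((growth (picard_limit l1) l1 - growth (picard_limit l2) l1) +
     (growth (picard_limit l2) l1 - growth (picard_limit l2) l2)) by ring.
  eapply Rle_trans; [apply Rabs_triang|]; rewrite Rmult_plus_distr_r.
  apply Rplus_le_compat.
  - rewrite Rmult_assoc; apply growth_diff; trivial; [lra|].
    rewrite Rabs_minus_sym, (Rabs_pos_eq (l2 - l1)) by lra.
    apply solves_compare; trivial; apply picard_limit_solves; lra.
  - apply growth_lipschitz; trivial; lra. }
intros l1 l2 H1 H2; destruct (Rle_dec l1 l2).
- apply Hle; lra.
- rewrite Rabs_minus_sym, (Rabs_minus_sym l1); apply Hle; lra.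
Qed.

End IntegralEquation.

(** * Pointwise form of the hypotheses on the coefficients *)

Lemma in_C_const (r : R) : in_C (fun _ => r).
Proof.
split.
- intros p _; apply filterlim_const.
- exists (Rabs r); intros; lra.
Qed.

Lemma quarter_plane_1_1 : quarter_plane (1, 1).
Proof. split; simpl; lra. Qed.

Lemma sup_norm_const (r : R) : sup_norm (fun _ => r) = Finite (Rabs r).
Proof.
apply is_lub_Rbar_unique; split.
- intros x [p [_ ->]]; simpl; lra.
- intros l Hl; apply Hl; exists (1, 1); split; trivial; apply quarter_plane_1_1.
Qed.

(** Constant temperatures lie in the space, so each real [r] is tested by one of them. *)
Lemma bounded_on_C_pointwise (g : R -> R) (gm gM : R) :
  bounded_on_C g gm gM -> forall r, gm <= g r <= gM.
Proof.
intros Hg r; exact (Hg (fun _ => r) (in_C_const r) (1, 1) quarter_plane_1_1).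
Qed.

(** On constant temperatures both supremum norms are finite, and the inequality in [Rbar] reduces to
    one between reals. *)
Lemma lipschitz_on_C_pointwise (g : R -> R) (L : R) :
  lipschitz_on_C g L -> forall r r', Rabs (g r - g r') <= L * Rabs (r - r').
Proof.
intros Hg r r'.
specialize (Hg (fun _ => r) (fun _ => r') (in_C_const r) (in_C_const r')).
change (Rbar_le (sup_norm (fun _ => g r - g r'))
  (Rbar_mult L (sup_norm (fun _ => r - r')))) in Hg.
now rewrite !sup_norm_const in Hg.
Qed.

(** * Lipschitz quotients and equality in integral inequalities *)

Lemma quotient_lipschitz (u u' v v' m M a c delta : R) :
  0 < m -> m <= v -> m <= v' -> Rabs u' <= M -> 0 <= delta ->
  Rabs (u - u') <= a * delta -> Rabs (v - v') <= c * delta ->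
  Rabs (u / v - u' / v') <= (M * c + m * a) / m ^ 2 * delta.
Proof.
intros Hm Hv Hv' Hu' Hd Hu Hvv.
(* Each term varies only one of numerator and denominator; the contributions are [a / m] and
   [M * c / m ^ 2]. *)
replace (u / v - u' / v') with ((u - u') / v + u' / v' * ((v' - v) / v))
  by (field; lra).
assert (Hinv : 0 < / v <= / m /\ 0 < / v' <= / m).
{ repeat split; try (apply Rinv_0_lt_compat; lra); apply Rinv_le_contravar; lra. }
replace ((M * c + m * a) / m ^ 2 * delta) with
  (a * delta * / m + M * / m * (c * delta * / m)) by (field; lra).
eapply Rle_trans; [apply Rabs_triang|]; unfold Rdiv; rewrite !Rabs_mult.
rewrite (Rabs_pos_eq (/ v)), (Rabs_pos_eq (/ v')), (Rabs_minus_sym v') by lra.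
pose proof (Rabs_pos u'); pose proof (Rabs_pos (u - u')); pose proof (Rabs_pos (v - v')).
repeat first [apply Rplus_le_compat | apply Rmult_le_compat];
  try lra; repeat apply Rmult_le_pos; lra.
Qed.

Lemma affine_cont (p n s : R) : continuous (fun s => p - s * n) s.
Proof.
apply (ex_derive_continuous (fun s => p - s * n)); auto_derive; trivial.
Qed.

Lemma RInt_affine (p n z : R) : RInt (fun s => p - s * n) 0 z = z * p - z ^ 2 * n / 2.
Proof.
apply is_RInt_unique.
replace (z * p - z ^ 2 * n / 2) with
  (minus (z * p - z ^ 2 * n / 2) (0 * p - 0 ^ 2 * n / 2))
  by (unfold minus, plus, opp; simpl; field).
apply (is_RInt_derive (fun s => s * p - s ^ 2 * n / 2)).
- intros s _; auto_derive; trivial; field.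
- intros s _; apply affine_cont.
Qed.

(** The integrals over [[0,x]] and over [[x,z]] are both ordered, so equality of the total forces
    equality at each [x]. Differentiating the vanishing difference gives the claim at interior
    points. *)
Lemma RInt_eq_pointwise (u v : R -> R) (z : R) :
  (forall s, continuous u s) -> (forall s, continuous v s) ->
  (forall s, 0 <= s <= z -> u s <= v s) -> RInt v 0 z <= RInt u 0 z ->
  forall s, 0 < s < z -> u s = v s.
Proof.
intros Hu Hv Huv Hint s Hs.
assert (Hle : forall x y, 0 <= x <= y -> y <= z -> RInt u x y <= RInt v x y).
{ intros x y Hx Hy; apply RInt_le; try lra; try now apply continuous_ex_RInt.
  intros t Ht; apply Huv; lra. }
assert (Heq : forall x, 0 <= x <= z -> RInt u 0 x - RInt v 0 x = 0).
{ intros x Hx; rewrite (RInt_split u 0 x z), (RInt_split v 0 x z) in Hint by trivial.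
  assert (H1 := Hle 0 x); assert (H2 := Hle x z); lra. }
assert (Hd : is_derive (fun x => RInt u 0 x - RInt v 0 x) s (u s - v s)).
{ apply (is_derive_minus (fun x => RInt u 0 x) (fun x => RInt v 0 x));
    now apply is_derive_RInt_upper. }
apply is_derive_unique in Hd.
rewrite (Derive_ext_loc _ (fun _ => 0)), Derive_const in Hd; [lra|].
assert (Hpos : 0 < Rmin s (z - s)) by (apply Rmin_glb_lt; lra).
exists (mkposreal _ Hpos); intros y Hy; apply Heq.
unfold ball in Hy; simpl in Hy; unfold AbsRing_ball, abs, minus, plus, opp in Hy.
simpl in Hy; apply Rabs_def2 in Hy.
pose proof (Rmin_l s (z - s)); pose proof (Rmin_r s (z - s)); lra.
Qed.

Lemma continuous_eq_const_closure (u : R -> R) (a b c : R) :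
  a < b -> (forall x, continuous u x) -> (forall x, a < x < b -> u x = c) ->
  forall x, a <= x <= b -> u x = c.
Proof.
intros Hab Hu Hc x Hx.
destruct (Req_dec (u x) c) as [E|Hne]; trivial; exfalso.
assert (Heps : 0 < Rabs (u x - c)) by (apply Rabs_pos_lt; lra).
pose proof (Hu x) as Hux; apply continuity_pt_filterlim in Hux.
destruct (Hux _ Heps) as [delta [Hdelta Hux']].
assert (Hy : exists y, a < y < b /\ y <> x /\ Rabs (y - x) < delta).
(* [y] is reached from [x] by a step toward the farther endpoint; at most a quarter of the length
   keeps it inside. *)
{ destruct (Rlt_le_dec x ((a + b) / 2)).
  - exists (x + Rmin (delta / 2) ((b - a) / 4)).
    assert (0 < Rmin (delta / 2) ((b - a) / 4)) by (apply Rmin_glb_lt; lra).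
    pose proof (Rmin_l (delta / 2) ((b - a) / 4)).
    pose proof (Rmin_r (delta / 2) ((b - a) / 4)).
    repeat split; try lra; rewrite Rabs_pos_eq; lra.
  - exists (x - Rmin (delta / 2) ((b - a) / 4)).
    assert (0 < Rmin (delta / 2) ((b - a) / 4)) by (apply Rmin_glb_lt; lra).
    pose proof (Rmin_l (delta / 2) ((b - a) / 4)).
    pose proof (Rmin_r (delta / 2) ((b - a) / 4)).
    repeat split; try lra; rewrite Rabs_left; lra. }
destruct Hy as [y [Hy1 [Hy2 Hy3]]].
assert (Hbad := Hux' y); simpl in Hbad; unfold R_dist in Hbad.
rewrite (Hc y Hy1), (Rabs_minus_sym c) in Hbad.
apply (Rlt_irrefl (Rabs (u x - c))), Hbad; repeat split; auto.
Qed.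

(** * The coefficients in the similarity variable *)

(** The starred coefficients as functions of the value [r = f xi]: [Lstar d f xi] is convertible to
    [L_at d (f xi)], and likewise for the other two. *)
Definition L_at (d : stefan_data) (r : R) : R := kT d (Tm d * r + Tm d) / k0 d.
Definition N_at (d : stefan_data) (r : R) : R :=
  rhoT d (Tm d * r + Tm d) * cT d (Tm d * r + Tm d) / (rho0 d * c0 d).
Definition mu_at (d : stefan_data) (r : R) : R :=
  muT d (Tm d * r + Tm d) / sqrt (rho0 d * c0 d * k0 d).

Definition drift (d : stefan_data) (s r : R) : R :=
  mu_at d r / L_at d r - s * (N_at d r / L_at d r).
Definition resistivity (d : stefan_data) (r : R) : R := / L_at d r.

Section Coefficients.

Variables (d : stefan_data) (b : stefan_bounds).
Hypotheses (Hd : positive_data d) (Hb : positive_bounds b).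
Hypotheses (HK : hyp_K d b) (HR : hyp_R d b) (HV : hyp_V d b).

(** One argument serves [k], [rho c] and [mu]. The slope of [r |-> Tm * r + Tm] accounts for the
    factor [Rabs (Tm d)] in the Lipschitz constants. *)
Lemma scaled_coefficient (g : R -> R) (gm gM gl c : R) :
  0 < c -> bounded_on_C g gm gM -> lipschitz_on_C g gl ->
  (forall r, gm / c <= g (Tm d * r + Tm d) / c <= gM / c) /\
  (forall r r', Rabs (g (Tm d * r + Tm d) / c - g (Tm d * r' + Tm d) / c) <=
    gl * Rabs (Tm d) / c * Rabs (r - r')).
Proof.
intros Hc Hg Hl; assert (Hi := Rinv_0_lt_compat c Hc); split.
- intros r; pose proof (bounded_on_C_pointwise _ _ _ Hg (Tm d * r + Tm d)).
  split; apply Rmult_le_compat_r; lra.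
- intros r r'.
  pose proof (lipschitz_on_C_pointwise _ _ Hl (Tm d * r + Tm d) (Tm d * r' + Tm d)) as H.
  replace (Tm d * r + Tm d - (Tm d * r' + Tm d)) with (Tm d * (r - r')) in H by ring.
  rewrite Rabs_mult in H; unfold Rdiv.
  rewrite <- Rmult_minus_distr_r, Rabs_mult, (Rabs_pos_eq (/ c)) by lra.
  apply Rmult_le_compat_r with (r := / c) in H; lra.
Qed.

Lemma rho0c0_pos : 0 < rho0 d * c0 d.
Proof. apply Rmult_lt_0_compat; apply Hd. Qed.

Lemma sqrt_pos_data : 0 < sqrt (rho0 d * c0 d * k0 d).
Proof. apply sqrt_lt_R0, Rmult_lt_0_compat; [apply rho0c0_pos | apply Hd]. Qed.

Lemma L_at_spec : (forall r, L_m d b <= L_at d r <= L_M d b) /\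
  (forall r r', Rabs (L_at d r - L_at d r') <= L_lip d b * Rabs (r - r')).
Proof. apply (scaled_coefficient (kT d)); [apply Hd | apply HK | apply HK]. Qed.

Lemma N_at_spec : (forall r, N_m d b <= N_at d r <= N_M d b) /\
  (forall r r', Rabs (N_at d r - N_at d r') <= N_lip d b * Rabs (r - r')).
Proof.
apply (scaled_coefficient (fun r => rhoT d r * cT d r));
  [apply rho0c0_pos | apply HR | apply HR].
Qed.

Lemma mu_at_spec : (forall r, mu_m d b <= mu_at d r <= mu_M d b) /\
  (forall r r', Rabs (mu_at d r - mu_at d r') <= mu_lip d b * Rabs (r - r')).
Proof.
apply (scaled_coefficient (muT d)); [apply sqrt_pos_data | apply HV | apply HV].
Qed.

Lemma bounds_pos :
  (0 < L_m d b /\ 0 < L_M d b /\ 0 < L_lip d b) /\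
  (0 < N_m d b /\ 0 < N_M d b /\ 0 < N_lip d b) /\
  (0 < mu_m d b /\ 0 < mu_M d b /\ 0 < mu_lip d b).
Proof.
assert (HT : 0 < Rabs (Tm d)) by (apply Rabs_pos_lt; apply Rgt_not_eq, Hd).
pose proof rho0c0_pos; pose proof sqrt_pos_data.
destruct Hd as (_ & _ & _ & _ & Hk0 & _), Hb as ((?&?&?)&(?&?&?)&(?&?&?)).
repeat split; apply Rdiv_lt_0_compat; trivial; now apply Rmult_lt_0_compat.
Qed.

Lemma L_at_pos (r : R) : 0 < L_at d r.
Proof. pose proof (proj1 L_at_spec r); pose proof bounds_pos; lra. Qed.

Lemma L_at_cont (r : R) : continuous (L_at d) r.
Proof. apply (lipschitz_continuous _ _ (proj2 L_at_spec)). Qed.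

Lemma N_at_cont (r : R) : continuous (N_at d) r.
Proof. apply (lipschitz_continuous _ _ (proj2 N_at_spec)). Qed.

Lemma mu_at_cont (r : R) : continuous (mu_at d) r.
Proof. apply (lipschitz_continuous _ _ (proj2 mu_at_spec)). Qed.

Lemma quotient_L_at_cont (u f : R -> R) :
  (forall r, continuous u r) -> (forall x, continuous f x) ->
  forall s, continuous (fun s => u (f s) / L_at d (f s)) s.
Proof.
intros Hu Hf s.
apply (continuous_mult (fun s => u (f s)) (fun s => / L_at d (f s))).
- apply continuous_comp; auto.
- apply (continuous_comp (fun s => L_at d (f s)) Rinv).
  + apply continuous_comp; [apply Hf | apply L_at_cont].
  + apply (continuous_Rinv (L_at d (f s))), Rgt_not_eq, L_at_pos.
Qed.

Lemma weighted_quotient_cont (f : R -> R) :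
  (forall x, continuous f x) ->
  forall s, continuous (fun s => s * (N_at d (f s) / L_at d (f s))) s.
Proof.
intros Hf s; apply (continuous_mult (fun s : R => s) (fun s => N_at d (f s) / L_at d (f s))).
- apply continuous_id.
- now apply (quotient_L_at_cont (N_at d)); [apply N_at_cont|].
Qed.

Lemma drift_cont (f : R -> R) : (forall x, continuous f x) ->
  forall s, continuous (fun s => drift d s (f s)) s.
Proof.
intros Hf s; apply (continuous_minus (fun s => mu_at d (f s) / L_at d (f s))).
- now apply (quotient_L_at_cont (mu_at d)); [apply mu_at_cont|].
- now apply weighted_quotient_cont.
Qed.

Lemma quotient_bounds (u v um uM vm vM : R) :
  0 < um -> 0 < vm -> um <= u <= uM -> vm <= v <= vM ->
  um / vM <= u / v <= uM / vm.
Proof.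
intros; split; apply Rmult_le_compat; try lra;
 try (left; apply Rinv_0_lt_compat; lra); apply Rinv_le_contravar; lra.
Qed.

Lemma mu_quotient_bounds (r : R) :
  mu_m d b / L_M d b <= mu_at d r / L_at d r <= mu_M d b / L_m d b.
Proof.
pose proof bounds_pos; apply quotient_bounds; try tauto.
- apply mu_at_spec.
- apply L_at_spec.
Qed.

Lemma N_quotient_bounds (r : R) :
  N_m d b / L_M d b <= N_at d r / L_at d r <= N_M d b / L_m d b.
Proof.
pose proof bounds_pos; apply quotient_bounds; try tauto.
- apply N_at_spec.
- apply L_at_spec.
Qed.

Lemma drift_bounds (s r : R) : 0 <= s ->
  mu_m d b / L_M d b - s * (N_M d b / L_m d b) <= drift d s r <=
  mu_M d b / L_m d b - s * (N_m d b / L_M d b).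
Proof.
intros Hs; pose proof (mu_quotient_bounds r); pose proof (N_quotient_bounds r).
unfold drift; nra.
Qed.

Lemma quotients_pos :
  0 < mu_m d b / L_M d b /\ 0 < N_m d b / L_M d b /\
  0 < mu_M d b / L_m d b /\ 0 < N_M d b / L_m d b.
Proof. pose proof bounds_pos; repeat split; apply Rdiv_lt_0_compat; tauto. Qed.

Lemma drift_le (s r : R) : 0 <= s -> drift d s r <= mu_M d b / L_m d b.
Proof. intros Hs; pose proof (drift_bounds s r Hs); pose proof quotients_pos; nra. Qed.

Lemma drift_abs (Lam s r : R) : 0 <= s <= Lam ->
  Rabs (drift d s r) <= mu_M d b / L_m d b + Lam * (N_M d b / L_m d b).
Proof.
intros Hs; pose proof (drift_bounds s r (proj1 Hs)); pose proof quotients_pos.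
apply Rabs_le; nra.
Qed.

(** The numerators are those of [D1] and [D2], which allows a term-by-term comparison with [E_q]. *)
Definition drift_lip (Lam : R) : R :=
  (mu_M d b * L_lip d b + L_m d b * mu_lip d b) / L_m d b ^ 2 +
  Lam * ((N_M d b * L_lip d b + L_m d b * N_lip d b) / L_m d b ^ 2).

Lemma drift_lipschitz (Lam s r r' : R) : 0 <= s <= Lam ->
  Rabs (drift d s r - drift d s r') <= drift_lip Lam * Rabs (r - r').
Proof.
intros Hs; pose proof bounds_pos as Hp; unfold drift, drift_lip.
assert (Hm : Rabs (mu_at d r / L_at d r - mu_at d r' / L_at d r') <=
  (mu_M d b * L_lip d b + L_m d b * mu_lip d b) / L_m d b ^ 2 * Rabs (r - r')).
{ apply quotient_lipschitz; try apply L_at_spec; try apply mu_at_spec; try tauto.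
  - pose proof (proj1 mu_at_spec r'); rewrite Rabs_pos_eq; lra.
  - apply Rabs_pos. }
assert (Hn : Rabs (N_at d r / L_at d r - N_at d r' / L_at d r') <=
  (N_M d b * L_lip d b + L_m d b * N_lip d b) / L_m d b ^ 2 * Rabs (r - r')).
{ apply quotient_lipschitz; try apply L_at_spec; try apply N_at_spec; try tauto.
  - pose proof (proj1 N_at_spec r'); rewrite Rabs_pos_eq; lra.
  - apply Rabs_pos. }
match goal with |- Rabs (?x - s * ?y - (?x' - s * ?y')) <= _ =>
  replace (x - s * y - (x' - s * y')) with ((x - x') + - (s * (y - y'))) by ring end.
eapply Rle_trans; [apply Rabs_triang|].
rewrite Rabs_Ropp, Rabs_mult, (Rabs_pos_eq s), Rmult_plus_distr_r by lra.
apply Rplus_le_compat; trivial; rewrite Rmult_assoc.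
apply Rmult_le_compat; trivial; try lra; apply Rabs_pos.
Qed.

Lemma resistivity_range (r : R) : 0 <= resistivity d r <= / L_m d b.
Proof.
pose proof (proj1 L_at_spec r); pose proof bounds_pos; unfold resistivity; split.
- left; apply Rinv_0_lt_compat; lra.
- apply Rinv_le_contravar; lra.
Qed.

Lemma resistivity_lipschitz (r r' : R) :
  Rabs (resistivity d r - resistivity d r') <=
  L_lip d b / L_m d b ^ 2 * Rabs (r - r').
Proof.
pose proof bounds_pos.
replace (resistivity d r - resistivity d r') with (1 / L_at d r - 1 / L_at d r')
  by (unfold resistivity, Rdiv; ring).
replace (L_lip d b / L_m d b ^ 2) with ((1 * L_lip d b + L_m d b * 0) / L_m d b ^ 2)
  by (f_equal; ring).
apply quotient_lipschitz; try apply L_at_spec; try tauto.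
- rewrite Rabs_R1; lra.
- apply Rabs_pos.
- rewrite Rminus_diag, Rabs_R0; lra.
Qed.

Lemma q_star_pos : 0 < q_star d.
Proof.
pose proof rho0c0_pos; unfold q_star, alpha0.
destruct Hd as (?&?&?&?&?&?).
apply Rdiv_lt_0_compat; repeat apply Rmult_lt_0_compat; try lra.
apply sqrt_lt_R0; now apply Rdiv_lt_0_compat.
Qed.

(** The left side is the abstract factor [qs * Lam * C] with [P = mu_M / L_m], [G = / L_m],
    [K = L_lip / L_m ^ 2] and [H = drift_lip Lam]. Once common factors are removed, [E_q] dominates
    term by term: some coefficients are doubled and a factor [exp (N_M / L_m * Lam ^ 2) >= 1]
    appears. *)
Lemma contraction_le_E_q (Lam : R) : 0 <= Lam ->
  q_star d * Lam * (exp (2 * (mu_M d b / L_m d b) * Lam) *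
    (L_lip d b / L_m d b ^ 2 + 2 * Lam * drift_lip Lam * / L_m d b)) <= E_q d b Lam.
Proof.
intros HLam; pose proof q_star_pos; pose proof bounds_pos as Hp.
destruct Hp as ((?&?&?)&(?&?&?)&(?&?&?)).
unfold E_q, D4, D3, D1, D2, drift_lip.
replace (2 * mu_M d b * Lam / L_m d b) with (2 * (mu_M d b / L_m d b) * Lam)
  by (field; lra).
replace (2 * Lam * (mu_M d b / L_m d b)) with (2 * (mu_M d b / L_m d b) * Lam) by ring.
replace (N_M d b * Lam ^ 2 / L_m d b) with (N_M d b / L_m d b * Lam ^ 2)
  by (field; lra).
set (e := exp (2 * (mu_M d b / L_m d b) * Lam)).
assert (He : 0 < e) by apply exp_pos.
assert (He' : 1 <= exp (N_M d b / L_m d b * Lam ^ 2)).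
{ rewrite <- exp_0; apply exp_le, Rmult_le_pos.
  - left; apply quotients_pos.
  - apply pow_le; lra. }
set (e' := exp (N_M d b / L_m d b * Lam ^ 2)) in *.
set (A := mu_M d b * L_lip d b + L_m d b * mu_lip d b).
set (A' := N_M d b * L_lip d b + L_m d b * N_lip d b).
assert (HA : 0 < A) by (unfold A; nra).
assert (HA' : 0 < A') by (unfold A'; nra).
match goal with |- ?x <= ?y =>
  replace x with (q_star d * Lam * / L_m d b ^ 2 * e *
    (L_lip d b + (2 * Lam * A + 2 * Lam ^ 2 * A') / L_m d b)) by (field; lra);
  replace y with (q_star d * Lam * / L_m d b ^ 2 * e *
    (2 * L_lip d b + (e' * (4 * Lam * A + 2 * Lam ^ 2 * A')) / L_m d b))
    by (field; lra)
end.
apply Rmult_le_compat_l.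
{ assert (0 < / L_m d b ^ 2) by (apply Rinv_0_lt_compat, pow_lt; lra).
  apply Rmult_le_pos; [apply Rmult_le_pos; [apply Rmult_le_pos|]|]; lra. }
apply Rplus_le_compat; [lra|].
apply Rmult_le_compat_r; [left; apply Rinv_0_lt_compat; lra|].
assert (0 <= Lam * A) by (apply Rmult_le_pos; lra).
assert (0 <= Lam ^ 2 * A') by (apply Rmult_le_pos; [apply pow_le|]; lra).
nra.
Qed.

(** * The integral equation in terms of [drift] and [resistivity] *)

Notation expo := (growth (drift d)).
Notation dPhi := (kernel (drift d) (resistivity d)).
Notation solution := (picard_limit (drift d) (resistivity d) (q_star d)).
Notation solves_eq := (solves (drift d) (resistivity d) (q_star d)).

Lemma dPhi_cont (f : R -> R) : (forall x, continuous f x) ->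
  forall z, continuous (dPhi f) z.
Proof. exact (kernel_cont _ _ _ drift_cont resistivity_lipschitz f). Qed.

Lemma E_fun_eq (f : R -> R) (z : R) :
  (forall x, continuous f x) -> E_fun d f z = expo f z.
Proof.
intros Hf; unfold E_fun, U_fun, I_fun, growth.
unfold Rdiv at 1; rewrite <- exp_Ropp, <- exp_plus; f_equal.
rewrite (RInt_ext (fun s => s * Nstar d f s / Lstar d f s)
  (fun s => s * (N_at d (f s) / L_at d (f s)))).
2:{ intros s _; unfold Rdiv; apply Rmult_assoc. }
match goal with |- 2 * ?a + - (2 * ?b) = _ =>
  replace (2 * a + - (2 * b)) with (2 * (a - b)) by ring end.
f_equal; apply (RInt_sub (fun s => mu_at d (f s) / L_at d (f s))
   (fun s => s * (N_at d (f s) / L_at d (f s)))).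
- now apply (quotient_L_at_cont (mu_at d)); [apply mu_at_cont|].
- now apply weighted_quotient_cont.
Qed.

Lemma Phi_eq (f : R -> R) (z : R) :
  (forall x, continuous f x) -> Phi d f z = RInt (dPhi f) 0 z.
Proof.
intros Hf; unfold Phi; apply RInt_ext; intros x _.
now rewrite E_fun_eq.
Qed.

Lemma E_fun_ext (f g : R -> R) (lam z : R) :
  (forall x, 0 <= x <= lam -> f x = g x) -> 0 <= z <= lam ->
  E_fun d f z = E_fun d g z.
Proof.
intros Hfg Hz; unfold E_fun, U_fun, I_fun.
f_equal; do 2 f_equal; apply RInt_ext; rewrite Rmin_left, Rmax_right by lra;
  intros x Hx; unfold mustar, Nstar, Lstar, T_of; rewrite Hfg; lra.
Qed.

Lemma Phi_ext (f g : R -> R) (lam z : R) :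
  (forall x, 0 <= x <= lam -> f x = g x) -> 0 <= z <= lam ->
  Phi d f z = Phi d g z.
Proof.
intros Hfg Hz; unfold Phi.
apply RInt_ext; rewrite Rmin_left, Rmax_right by lra; intros x Hx.
rewrite (E_fun_ext f g lam) by (trivial; lra).
unfold Lstar, T_of; rewrite Hfg; lra.
Qed.

Lemma solves_integral_solution (lam : R) (f : R -> R) :
  (forall x, continuous f x) -> solves_eq lam f -> integral_solution d lam f.
Proof.
intros Hf Hs; split.
- intros x _; apply (filterlim_filter_le_1 _ (filter_le_within _)), Hf.
- intros x Hx; rewrite (Hs x Hx), !Phi_eq by trivial.
  rewrite (RInt_split _ 0 x lam) by now apply dPhi_cont.
  ring.
Qed.

(** A competitor is known to be continuous on [[0,lam]] only. Its clamped extension is continuous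
    everywhere and solves the same equation, since values outside [[0,lam]] do not enter. *)
Lemma integral_solution_solves (lam : R) (f : R -> R) :
  0 <= lam -> integral_solution d lam f ->
  (forall x, continuous (fun y => f (clamp 0 lam y)) x) /\
  solves_eq lam (fun y => f (clamp 0 lam y)).
Proof.
intros Hlam [Hf He].
assert (Hc := continuous_on_clamp 0 lam f Hlam Hf); split; trivial.
intros x Hx; rewrite clamp_id, He by trivial.
assert (Hext : forall y, 0 <= y <= lam -> f y = f (clamp 0 lam y)).
{ intros y Hy; now rewrite clamp_id. }
rewrite (Phi_ext _ _ lam lam Hext), (Phi_ext _ _ lam x Hext) by lra.
rewrite !Phi_eq by trivial.
rewrite (RInt_split _ 0 x lam) by now apply dPhi_cont.
f_equal; ring.
Qed.

(** * Bounds on [E(f)] and the case of equality *)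

Lemma expo_lower (f : R -> R) (z : R) : (forall x, continuous f x) -> 0 < z ->
  exp (- (z ^ 2 * (N_M d b / L_m d b))) < expo f z.
Proof.
intros Hf Hz; apply exp_increasing.
assert (H : RInt (fun s => mu_m d b / L_M d b - s * (N_M d b / L_m d b)) 0 z <=
  RInt (fun s => drift d s (f s)) 0 z).
{ apply RInt_le; try lra.
  - apply continuous_ex_RInt, affine_cont.
  - now apply continuous_ex_RInt, drift_cont.
  - intros s Hs; apply drift_bounds; lra. }
rewrite RInt_affine in H.
(* Dropping this positive term from the exponent makes the bound strict, which later excludes [lam1]
   as a fixed point. *)
assert (0 < z * (mu_m d b / L_M d b)) by (apply Rmult_lt_0_compat; [|apply quotients_pos]; trivial).
lra.
Qed.

Lemma expo_upper (f : R -> R) (z : R) : (forall x, continuous f x) -> 0 <= z ->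
  expo f z <= exp (2 * z * (mu_M d b / L_m d b) - z ^ 2 * (N_m d b / L_M d b)).
Proof.
intros Hf Hz; apply exp_le.
assert (H : RInt (fun s => drift d s (f s)) 0 z <=
  RInt (fun s => mu_M d b / L_m d b - s * (N_m d b / L_M d b)) 0 z).
{ apply RInt_le; try lra.
  - now apply continuous_ex_RInt, drift_cont.
  - apply continuous_ex_RInt, affine_cont.
  - intros s Hs; apply drift_bounds; lra. }
rewrite RInt_affine in H; lra.
Qed.

Lemma expo_upper_attained (f : R -> R) (z : R) : (forall x, continuous f x) ->
  0 <= z ->
  exp (2 * z * (mu_M d b / L_m d b) - z ^ 2 * (N_m d b / L_M d b)) <= expo f z ->
  forall s, 0 < s < z ->
  drift d s (f s) = mu_M d b / L_m d b - s * (N_m d b / L_M d b).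
Proof.
intros Hf Hz Hle; apply RInt_eq_pointwise.
- now apply drift_cont.
- apply affine_cont.
- intros s Hs; apply drift_bounds; lra.
- rewrite RInt_affine; apply Rnot_lt_le; intros Hlt.
  apply (Rle_not_lt _ _ Hle), exp_increasing; lra.
Qed.

(** Attaining the bound fixes [drift] along [(0,z)]. As [drift] is built from two separately bounded
    quotients, both are extremal. The first forces [L^*] to be minimal and the second forces it to
    be maximal, whence [k_m = k_M]. Continuity adds the endpoints. *)
Lemma extremal_of_attained (f : R -> R) (z : R) : (forall x, continuous f x) ->
  0 < z ->
  exp (2 * z * (mu_M d b / L_m d b) - z ^ 2 * (N_m d b / L_M d b)) <= expo f z ->
  extremal_coefficients d b z f.
Proof.
intros Hf Hz Hle.
pose proof bounds_pos as ((?&?&?)&(?&?&?)&(?&?&?)).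
pose proof (expo_upper_attained f z Hf (Rlt_le _ _ Hz) Hle) as Hdrift.
assert (Hall : forall s, 0 < s < z ->
  mu_at d (f s) = mu_M d b /\ N_at d (f s) = N_m d b /\ L_m d b = L_M d b).
{ intros s Hs; specialize (Hdrift s Hs); unfold drift in Hdrift.
  pose proof (mu_quotient_bounds (f s)) as Bm.
  pose proof (N_quotient_bounds (f s)) as Bn.
  assert (Em : mu_at d (f s) / L_at d (f s) = mu_M d b / L_m d b) by nra.
  assert (En : N_at d (f s) / L_at d (f s) = N_m d b / L_M d b) by nra.
  pose proof (proj1 L_at_spec (f s)); pose proof (proj1 mu_at_spec (f s)).
  pose proof (proj1 N_at_spec (f s)).
  (* Clearing denominators gives [mu * L_m = mu_M * L]; with [mu <= mu_M] and [L_m <= L] this leaves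
     only equalities. The relation for [N] is treated alike. *)
  apply Rmult_eq_compat_r with (r := L_at d (f s) * L_m d b) in Em.
  apply Rmult_eq_compat_r with (r := L_at d (f s) * L_M d b) in En.
  field_simplify in Em; [|lra|lra]; field_simplify in En; [|lra|lra].
  assert (L_at d (f s) = L_m d b) by nra.
  assert (L_at d (f s) = L_M d b) by nra.
  repeat split; try lra; nra. }
assert (Hmu : forall x, 0 <= x <= z -> mu_at d (f x) = mu_M d b).
{ apply (continuous_eq_const_closure (fun x => mu_at d (f x))); trivial.
  - intros x; apply continuous_comp; [apply Hf | apply mu_at_cont].
  - intros x Hx; now apply Hall. }
assert (HN : forall x, 0 <= x <= z -> N_at d (f x) = N_m d b).
{ apply (continuous_eq_const_closure (fun x => N_at d (f x))); trivial.
  - intros x; apply continuous_comp; [apply Hf | apply N_at_cont].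
  - intros x Hx; now apply Hall. }
pose proof rho0c0_pos; pose proof sqrt_pos_data.
split.
- destruct (Hall (z / 2)) as (_ & _ & E); [lra|].
  apply (Rmult_eq_reg_r (/ k0 d)); [exact E|].
  apply Rinv_neq_0_compat, Rgt_not_eq, Hd.
- intros x Hx; split.
  + apply (Rmult_eq_reg_r (/ sqrt (rho0 d * c0 d * k0 d))); [now apply Hmu|].
    apply Rinv_neq_0_compat; lra.
  + apply (Rmult_eq_reg_r (/ (rho0 d * c0 d))); [now apply HN|].
    apply Rinv_neq_0_compat; lra.
Qed.

Lemma M_const_pos : 0 < M_const d.
Proof.
pose proof (bounded_on_C_pointwise _ _ _ (proj1 HK) (Tm d)) as Hk.
destruct Hd as (?&?&?&?&?&?), Hb as ((?&?&?)&_).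
apply Rdiv_lt_0_compat; repeat apply Rmult_lt_0_compat; lra.
Qed.

(** * Monotonicity and threshold of [E_q] *)

Lemma E_q_lt (z z' : R) : 0 <= z < z' -> E_q d b z < E_q d b z'.
Proof.
intros Hz; pose proof q_star_pos; pose proof quotients_pos as (_&_&Hp&Hn).
pose proof bounds_pos as ((?&?&?)&(?&?&?)&(?&?&?)).
set (A := mu_M d b * L_lip d b + L_m d b * mu_lip d b).
set (A' := N_M d b * L_lip d b + L_m d b * N_lip d b).
assert (HA : 0 < A) by (unfold A; nra).
assert (HA' : 0 < A') by (unfold A'; nra).
(* Up to a positive constant, [E_q] is [z * X z]. On nonnegative arguments [X] is positive and
   nondecreasing, and the factor [z] supplies strictness. *)
set (X := fun z => exp (2 * (mu_M d b / L_m d b) * z) *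
  (L_lip d b + exp (N_M d b / L_m d b * z ^ 2) * (2 * z * A + z ^ 2 * A') / L_m d b)).
assert (HE : forall z, E_q d b z = 2 * q_star d / L_m d b ^ 2 * (z * X z)).
{ intros y; unfold E_q, D4, D3, D1, D2, X.
  replace (2 * mu_M d b * y / L_m d b) with (2 * (mu_M d b / L_m d b) * y)
    by (field; lra).
  replace (2 * y * (mu_M d b / L_m d b)) with (2 * (mu_M d b / L_m d b) * y) by ring.
  replace (N_M d b * y ^ 2 / L_m d b) with (N_M d b / L_m d b * y ^ 2)
    by (field; lra).
  fold A A'; field; lra. }
assert (Hz2 : z ^ 2 <= z' ^ 2) by (apply pow_incr; lra).
assert (HXz : 0 < X z).
{ apply Rmult_lt_0_compat; [apply exp_pos|].
  apply Rplus_lt_le_0_compat; trivial.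
  apply Rdiv_le_0_compat; trivial; apply Rmult_le_pos; [left; apply exp_pos|].
  pose proof (pow2_ge_0 z); nra. }
assert (HXX : X z <= X z').
{ apply Rmult_le_compat; [left; apply exp_pos| | apply exp_le; nra |].
  - apply Rplus_le_le_0_compat; [lra|].
    apply Rdiv_le_0_compat; trivial; apply Rmult_le_pos; [left; apply exp_pos|].
    pose proof (pow2_ge_0 z); nra.
  - apply Rplus_le_compat_l, Rmult_le_compat_r; [left; now apply Rinv_0_lt_compat|].
    apply Rmult_le_compat; [left; apply exp_pos| |apply exp_le; nra|].
    + pose proof (pow2_ge_0 z); nra.
    + nra. }
rewrite !HE; apply Rmult_lt_compat_l; [|nra].
apply Rdiv_lt_0_compat; [lra | apply pow_lt; lra].
Qed.

(** Keeping only the [L_lip] term of [D4] and bounding its exponential below by [1] gives linear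
    growth, so that [E_q] reaches [1]. *)
Lemma E_q_ge (z : R) : 0 <= z ->
  2 * q_star d * L_lip d b / L_m d b ^ 2 * z <= E_q d b z.
Proof.
intros Hz; pose proof q_star_pos; pose proof bounds_pos as ((?&?&?)&(?&?&?)&(?&?&?)).
pose proof quotients_pos as (_&_&Hp&Hn).
assert (He : 1 <= exp (2 * z * (mu_M d b / L_m d b))).
{ rewrite <- exp_0; apply exp_le; nra. }
assert (HL : 0 < L_m d b ^ 2) by (apply pow_lt; lra).
assert (HD : 0 <= D3 d b z).
{ unfold D3, D1, D2.
  apply Rplus_le_le_0_compat; apply Rmult_le_pos; try (left; apply exp_pos);
  (apply Rmult_le_pos; [|nra]); apply Rmult_le_pos; try (apply pow_le; lra);
    try lra; apply Rdiv_le_0_compat; trivial; try (left; apply exp_pos).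
  pose proof (exp_pos (2 * mu_M d b * z / L_m d b)); lra. }
unfold E_q, D4.
replace (2 * q_star d * L_lip d b / L_m d b ^ 2 * z) with
  (2 * q_star d * z * (1 / L_m d b ^ 2 * L_lip d b)) by (field; lra).
apply Rmult_le_compat_l; [nra|].
apply Rmult_le_compat_l; [left; apply Rdiv_lt_0_compat; lra|].
nra.
Qed.

Lemma E_q_threshold (Lam : R) : 0 < Lam -> E_q d b Lam < 1 ->
  exists lam_bar, unique (fun z => 0 < z /\ E_q d b z = 1) lam_bar /\ Lam < lam_bar.
Proof.
intros HLam HE; pose proof q_star_pos.
pose proof bounds_pos as ((?&?&?)&(?&?&?)&(?&?&?)).
(* The slope of the linear lower bound: [E_q] is at least [1] at [/ c]. *)
set (c := 2 * q_star d * L_lip d b / L_m d b ^ 2).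
assert (Hc : 0 < c).
{ apply Rdiv_lt_0_compat; [|apply pow_lt; lra].
  apply Rmult_lt_0_compat; lra. }
assert (Hbig : 1 <= E_q d b (/ c)).
{ assert (0 < / c) by now apply Rinv_0_lt_compat.
  rewrite <- (Rinv_r c) by lra; apply E_q_ge; lra. }
assert (HE0 : E_q d b 0 = 0) by (unfold E_q; ring).
destruct (IVT_gen (E_q d b) 0 (/ c) 1) as [z [Hz Ez]].
- intros z; apply continuity_pt_filterlim, (ex_derive_continuous (E_q d b)).
  unfold E_q, D4, D3, D1, D2; auto_derive; repeat split; trivial.
- rewrite HE0, Rmin_left, Rmax_right by lra; lra.
- rewrite Rmin_left in Hz by (left; now apply Rinv_0_lt_compat).
  assert (Hlt : Lam < z).
  { apply Rnot_le_lt; intros Hle.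
    assert (E_q d b z <= E_q d b Lam); [|lra].
    destruct Hle as [Hle| ->]; [left; apply E_q_lt|]; lra. }
  exists z; split; trivial; split; [split; lra|].
  intros z' [Hz' Ez'].
  destruct (Rtotal_order z z') as [Hlt'|[E|Hlt']]; trivial; exfalso.
  + assert (E_q d b z < E_q d b z') by (apply E_q_lt; lra); lra.
  + assert (E_q d b z' < E_q d b z) by (apply E_q_lt; lra); lra.
Qed.

(** * The fixed point of V^q *)

Section FixedPoint.

Variable Lam : R.
Hypotheses (HLam : 0 < Lam) (HE : E_q d b Lam < 1).

Lemma contraction_condition :
  q_star d * Lam * (exp (2 * (mu_M d b / L_m d b) * Lam) *
    (L_lip d b / L_m d b ^ 2 + 2 * Lam * drift_lip Lam * / L_m d b)) < 1.
Proof. eapply Rle_lt_trans; [apply contraction_le_E_q; lra | trivial]. Qed.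

(** After [eapply], constants of the abstract section remain as existential variables; the estimates
    listed here fix them by unification. *)
Ltac side_conditions :=
  try first
  [ exact drift_cont
  | exact (drift_lipschitz Lam)
  | exact (fun s r => drift_abs Lam s r)
  | exact (fun s r Hs => drift_le s r (proj1 Hs))
  | exact resistivity_range
  | exact resistivity_lipschitz
  | exact contraction_condition
  | exact (Rlt_le _ _ q_star_pos)
  | exact (Rlt_le _ _ HLam)
  | exact (Rlt_le _ _ (proj1 (proj2 (proj2 quotients_pos)))) ].

Lemma solution_cont (lam : R) : 0 <= lam <= Lam ->
  forall x, continuous (solution lam) x.
Proof. revert lam; eapply picard_limit_cont; side_conditions. Qed.

Lemma solution_solves (lam : R) : 0 <= lam <= Lam -> solves_eq lam (solution lam).
Proof. revert lam; eapply picard_limit_solves; side_conditions. Qed.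

Lemma endpoint_expo_lipschitz : exists D, forall l1 l2,
  0 <= l1 <= Lam -> 0 <= l2 <= Lam ->
  Rabs (expo (solution l1) l1 - expo (solution l2) l2) <= D * Rabs (l1 - l2).
Proof.
eapply endpoint_growth_lipschitz with (Q := mu_M d b / L_m d b + Lam * (N_M d b / L_m d b));
  side_conditions.
Qed.

Lemma solves_unique_on_Lam (lam : R) (f1 f2 : R -> R) :
  (forall x, continuous f1 x) -> (forall x, continuous f2 x) ->
  0 <= lam <= Lam -> solves_eq lam f1 -> solves_eq lam f2 ->
  forall x, 0 <= x <= lam -> f1 x = f2 x.
Proof. revert lam f1 f2; eapply solves_unique; side_conditions. Qed.

Lemma solution_unique (lam : R) : 0 < lam <= Lam ->
  unique_integral_solution d lam (solution lam).
Proof.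
intros Hlam.
assert (Hc : forall x, continuous (solution lam) x) by (apply solution_cont; lra).
assert (Hs : solves_eq lam (solution lam)) by (apply solution_solves; lra).
split; [now apply solves_integral_solution|].
intros g Hg x Hx.
destruct (integral_solution_solves lam g) as [Hgc Hgs]; trivial; [lra|].
rewrite <- (clamp_id 0 lam x Hx) at 1; revert x Hx.
apply solves_unique_on_Lam with (f1 := fun y => g (clamp 0 lam y)); trivial; lra.
Qed.

Lemma solution_endpoint (lam : R) : 0 <= lam <= Lam -> solution lam lam = 0.
Proof.
intros Hlam; rewrite (solution_solves lam Hlam lam) by lra.
rewrite RInt_point; apply Rmult_0_r.
Qed.

(* The value [V^q(lam)], written with [f lam = 0] substituted in [L^*]. *)
Definition speed (lam : R) : R :=
  q_star d / (M_const d * L_at d 0) * expo (solution lam) lam.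

Lemma speed_eq (lam : R) : 0 < lam <= Lam ->
  q_star d / (M_const d * Lstar d (solution lam) lam) * E_fun d (solution lam) lam =
  speed lam.
Proof.
intros Hlam; rewrite E_fun_eq by (apply solution_cont; lra).
unfold Lstar, T_of; now rewrite solution_endpoint by lra.
Qed.

Lemma speed_gt_V1 (lam : R) : 0 < lam <= Lam -> V1 d b lam < speed lam.
Proof.
intros Hlam; pose proof q_star_pos; pose proof M_const_pos.
pose proof (L_at_pos 0); pose proof (proj1 L_at_spec 0); pose proof bounds_pos.
unfold V1, speed.
apply Rle_lt_trans with (q_star d / (M_const d * L_at d 0) *
  exp (- (lam ^ 2 * (N_M d b / L_m d b)))).
- apply Rmult_le_compat_r; [left; apply exp_pos|].
  apply Rmult_le_compat_l; [lra|].
  apply Rinv_le_contravar; [now apply Rmult_lt_0_compat|].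
  apply Rmult_le_compat_l; lra.
- apply Rmult_lt_compat_l.
  + apply Rdiv_lt_0_compat; trivial; now apply Rmult_lt_0_compat.
  + apply expo_lower; [apply solution_cont|]; lra.
Qed.

(** Only the prefactors differ, [L_at d 0] being at least [L_m]. Kept apart from the bound on
    [expo], this lets the case of equality cancel a common prefactor. *)
Lemma V2_ge (lam : R) :
  q_star d / (M_const d * L_at d 0) *
    exp (2 * lam * (mu_M d b / L_m d b) - lam ^ 2 * (N_m d b / L_M d b)) <= V2 d b lam.
Proof.
pose proof q_star_pos; pose proof M_const_pos.
pose proof (proj1 L_at_spec 0); pose proof bounds_pos.
apply Rmult_le_compat_r; [left; apply exp_pos|].
apply Rmult_le_compat_l; [lra|].
apply Rinv_le_contravar; [apply Rmult_lt_0_compat; lra|].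
apply Rmult_le_compat_l; lra.
Qed.

Lemma speed_le_V2 (lam : R) : 0 < lam <= Lam -> speed lam <= V2 d b lam.
Proof.
intros Hlam; eapply Rle_trans; [|apply V2_ge].
pose proof q_star_pos; pose proof M_const_pos; pose proof (L_at_pos 0).
apply Rmult_le_compat_l.
- left; apply Rdiv_lt_0_compat; trivial; now apply Rmult_lt_0_compat.
- apply expo_upper; [apply solution_cont|]; lra.
Qed.

Lemma speed_eq_V2_extremal (lam : R) : 0 < lam <= Lam -> V2 d b lam <= speed lam ->
  extremal_coefficients d b lam (solution lam).
Proof.
intros Hlam HV2; apply extremal_of_attained; try (apply solution_cont; lra); [lra|].
pose proof q_star_pos; pose proof M_const_pos; pose proof (L_at_pos 0).
apply Rmult_le_reg_l with (q_star d / (M_const d * L_at d 0)).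
- apply Rdiv_lt_0_compat; trivial; now apply Rmult_lt_0_compat.
- eapply Rle_trans; [apply V2_ge | exact HV2].
Qed.

Lemma speed_fixed_point (lam1 : R) :
  0 < lam1 < Lam -> V1 d b lam1 = lam1 -> V2 d b Lam = Lam ->
  exists lam, lam1 < lam <= Lam /\ speed lam = lam.
Proof.
intros H1 HV1 HV2.
destruct endpoint_expo_lipschitz as [D HD].
set (c := q_star d / (M_const d * L_at d 0)).
(* [IVT_cor] asks for continuity on the whole line, so [speed lam - lam] is extended beyond
   [[lam1,Lam]] by the clamp. *)
set (F := fun x => speed (clamp lam1 Lam x) - clamp lam1 Lam x).
assert (Hcl : forall x, lam1 <= clamp lam1 Lam x <= Lam)
  by (intros; apply clamp_range; lra).
assert (HF : forall x, continuous F x).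
{ apply (lipschitz_continuous (Rabs c * Rabs D + 1)); intros x y; unfold F.
  pose proof (Hcl x); pose proof (Hcl y); pose proof (clamp_lipschitz lam1 Lam x y) as Hxy.
  set (u := clamp lam1 Lam x) in *; set (v := clamp lam1 Lam y) in *.
  replace (speed u - u - (speed v - v)) with
    (c * (expo (solution u) u - expo (solution v) v) + (v - u))
    by (unfold speed; fold c; ring).
  eapply Rle_trans; [apply Rabs_triang|].
  rewrite Rmult_plus_distr_r, (Rabs_minus_sym v), Rabs_mult, Rmult_assoc.
  apply Rplus_le_compat; [|lra].
  apply Rmult_le_compat_l; [apply Rabs_pos|].
  eapply Rle_trans; [apply HD; lra|].
  apply Rle_trans with (Rabs D * Rabs (u - v)).
  - apply Rmult_le_compat_r; [apply Rabs_pos | apply Rle_abs].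
  - apply Rmult_le_compat_l; [apply Rabs_pos | trivial]. }
assert (HF1 : 0 < F lam1).
{ unfold F; rewrite clamp_id by lra.
  assert (V1 d b lam1 < speed lam1) by (apply speed_gt_V1; lra); lra. }
assert (HF2 : F Lam <= 0).
{ unfold F; rewrite clamp_id by lra.
  assert (speed Lam <= V2 d b Lam) by (apply speed_le_V2; lra); lra. }
destruct (IVT_cor F lam1 Lam) as [lam [Hlam E]].
- intros x; apply continuity_pt_filterlim, HF.
- lra.
- nra.
- exists lam.
  (* [F] is strictly positive at [lam1] but only known to be nonpositive at [Lam]; hence the
     half-open interval. *)
  assert (lam <> lam1) by (intros ->; lra).
  unfold F in E; rewrite clamp_id in E by trivial; split; lra.
Qed.

End FixedPoint.

Lemma is_derive_is_derive_within (D : R -> Prop) (f : R -> R) (x l : R) :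
  is_derive f x l -> is_derive_within D f x l.
Proof.
intros Hf; apply is_derive_Reals in Hf.
apply (filterlim_filter_le_1 _ (filter_le_within (F := locally' x) _)).
apply filterlim_locally; intros eps.
destruct (Hf eps (cond_pos eps)) as [delta Hdelta].
exists delta; intros y Hy Hne.
replace y with (x + (y - x)) at 1 by ring.
apply Hdelta; [lra | exact Hy].
Qed.

Lemma is_derive_affine_comp (F u : R -> R) (a x du l : R) :
  is_derive u x du -> is_derive F (u x) l ->
  is_derive (fun y => a * F (u y) + a) x (a * (du * l)).
Proof.
intros Hu HF.
replace (a * (du * l)) with (plus (a * (du * l)) 0) by apply Rplus_0_r.
apply (is_derive_plus (fun y => a * F (u y)) (fun _ => a)).
- apply (is_derive_scal (fun y => F (u y))), (is_derive_comp F u); trivial.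
- apply (is_derive_const a).
Qed.

(** * The similarity solution *)

(* Unlike [f], the profile is differentiable on the whole line; both agree on
   [0,lam], so the temperature built from it needs no one-sided derivative. *)
Definition profile (lam : R) (f : R -> R) (xi : R) : R :=
  q_star d * RInt (dPhi f) xi lam.

Section SimilaritySolution.

Variables (lam : R) (f : R -> R).
Hypotheses (Hlam : 0 < lam) (Hf : forall x, continuous f x).
Hypothesis Hsol : solves_eq lam f.
Hypothesis Hspeed : q_star d / (M_const d * L_at d 0) * expo f lam = lam.

Let T (x t : R) : R := Tm d * profile lam f (x / (2 * sqrt (alpha0 d * t))) + Tm d.
Let s (t : R) : R := 2 * lam * sqrt (alpha0 d * t).
Let Tx (x t : R) : R :=
  Tm d * (/ (2 * sqrt (alpha0 d * t)) *
    - (q_star d * dPhi f (x / (2 * sqrt (alpha0 d * t))))).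

Lemma alpha0_pos : 0 < alpha0 d.
Proof. apply Rdiv_lt_0_compat; [apply Hd | apply rho0c0_pos]. Qed.

Lemma profile_derive (xi : R) :
  is_derive (profile lam f) xi (- (q_star d * dPhi f xi)).
Proof.
rewrite Ropp_mult_distr_r.
apply (is_derive_scal (fun xi => RInt (dPhi f) xi lam)).
apply is_derive_RInt_lower; now apply dPhi_cont.
Qed.

Lemma similarity_range (x t : R) : 0 < t -> 0 <= x <= s t ->
  0 <= x / (2 * sqrt (alpha0 d * t)) <= lam.
Proof.
intros Ht Hx; pose proof alpha0_pos.
assert (Hr : 0 < sqrt (alpha0 d * t)) by (apply sqrt_lt_R0; nra).
split; [apply Rdiv_le_0_compat; lra|].
apply Rmult_le_reg_r with (2 * sqrt (alpha0 d * t)); [lra|].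
unfold Rdiv; rewrite Rmult_assoc, Rinv_l, Rmult_1_r by lra.
unfold s in Hx; lra.
Qed.

(** [resistivity] cancels the conductivity, so the flux is a multiple of [E(f)]. This makes it
    differentiable although [k] is only Lipschitz. *)
Lemma flux_eq (x t : R) : 0 < t -> 0 <= x <= s t ->
  kT d (T x t) * Tx x t =
  - (k0 d * Tm d * q_star d / (2 * sqrt (alpha0 d * t))) *
  expo f (x / (2 * sqrt (alpha0 d * t))).
Proof.
intros Ht Hx; pose proof alpha0_pos.
assert (Hr : 0 < sqrt (alpha0 d * t)) by (apply sqrt_lt_R0; nra).
pose proof (similarity_range x t Ht Hx) as Hxi.
unfold T, Tx, profile; rewrite <- (Hsol _ Hxi).
unfold kernel, resistivity.
set (xi := x / _) in *; set (r := sqrt _) in *.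
pose proof (L_at_pos (f xi)) as HL; unfold L_at in *.
assert (Hk0 : 0 < k0 d) by apply Hd.
assert (kT d (Tm d * f xi + Tm d) <> 0).
{ intros E; rewrite E in HL; unfold Rdiv in HL; lra. }
field; lra.
Qed.

Lemma Tx_derive (x t : R) : 0 < t -> is_derive (fun y => T y t) x (Tx x t).
Proof.
intros Ht; pose proof alpha0_pos.
assert (Hr : 0 < sqrt (alpha0 d * t)) by (apply sqrt_lt_R0; nra).
apply (is_derive_affine_comp (profile lam f)
  (fun y => y / (2 * sqrt (alpha0 d * t)))); [|apply profile_derive].
auto_derive; trivial; ring.
Qed.

Lemma Tt_derive (x t : R) : 0 < t ->
  is_derive (fun t' => T x t') t
    (Tm d * (- (x / (2 * sqrt (alpha0 d * t))) / (2 * t) *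
      - (q_star d * dPhi f (x / (2 * sqrt (alpha0 d * t)))))).
Proof.
intros Ht; pose proof alpha0_pos.
assert (Hat : 0 < alpha0 d * t) by nra.
assert (Hr : 0 < sqrt (alpha0 d * t)) by now apply sqrt_lt_R0.
apply (is_derive_affine_comp (profile lam f)
  (fun t => x / (2 * sqrt (alpha0 d * t)))); [|apply profile_derive].
auto_derive.
- repeat split; trivial; lra.
- assert (Hrr := sqrt_sqrt (alpha0 d * t) (Rlt_le _ _ Hat)).
  set (r := sqrt _) in *.
  (* Trading [alpha0] for [r * r / t] makes the goal rational in [r] and [t]. *)
  replace (alpha0 d) with (r * r / t) by (rewrite Hrr; field; lra).
  field; lra.
Qed.

Lemma flux_derive (x t : R) : 0 < t -> 0 < x < s t ->
  let xi := x / (2 * sqrt (alpha0 d * t)) in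
  is_derive (fun x' => kT d (T x' t) * Tx x' t) x
    (- (k0 d * Tm d * q_star d / (2 * sqrt (alpha0 d * t))) *
     (/ (2 * sqrt (alpha0 d * t)) * (2 * drift d xi (f xi) * expo f xi))).
Proof.
intros Ht Hx xi; pose proof alpha0_pos.
assert (Hr : 0 < sqrt (alpha0 d * t)) by (apply sqrt_lt_R0; nra).
(* [flux_eq] covers [[0, s t]] only, which is a neighbourhood of the interior point [x]. *)
apply is_derive_ext_loc with (fun x' =>
  - (k0 d * Tm d * q_star d / (2 * sqrt (alpha0 d * t))) *
  expo f (x' / (2 * sqrt (alpha0 d * t)))).
- apply (locally_interval _ x 0 (s t)); try (simpl; lra).
  intros y Hy1 Hy2; simpl in *; symmetry; apply flux_eq; trivial; lra.
- apply (is_derive_scal (fun x' => expo f (x' / (2 * sqrt (alpha0 d * t))))).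
  apply (is_derive_comp (expo f) (fun x' => x' / (2 * sqrt (alpha0 d * t)))).
  + apply growth_derive; [exact drift_cont | trivial].
  + auto_derive; trivial; ring.
Qed.

(** In the derivative of the flux, the [mu^*] part of [drift] cancels the convection term, and the
    [N^*] part equals the left side. *)
Lemma heat_equation (x t : R) : 0 < t -> 0 < x < s t ->
  let xi := x / (2 * sqrt (alpha0 d * t)) in
  rhoT d (T x t) * cT d (T x t) *
    (Tm d * (- xi / (2 * t) * - (q_star d * dPhi f xi))) =
  - (k0 d * Tm d * q_star d / (2 * sqrt (alpha0 d * t))) *
     (/ (2 * sqrt (alpha0 d * t)) * (2 * drift d xi (f xi) * expo f xi)) -
  velocity d (T x t) t * Tx x t.
Proof.
intros Ht Hx xi; pose proof alpha0_pos; pose proof rho0c0_pos as Hrc.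
assert (Hat : 0 < alpha0 d * t) by nra.
assert (Hr : 0 < sqrt (alpha0 d * t)) by now apply sqrt_lt_R0.
assert (Hst : 0 < sqrt t) by now apply sqrt_lt_R0.
assert (Hk0 : 0 < k0 d) by apply Hd.
assert (Hxi : 0 <= xi <= lam) by (apply similarity_range; lra).
assert (HT : T x t = Tm d * f xi + Tm d).
{ unfold T, profile; fold xi; now rewrite <- (Hsol _ Hxi). }
assert (Hrr : sqrt (alpha0 d * t) * sqrt (alpha0 d * t) = alpha0 d * t)
  by (apply sqrt_sqrt; lra).
(* [Hv] and [Hk0r] express the other square roots and [k0] through [sqrt (alpha0 d * t)], after
   which the equation is an identity of rational functions. *)
assert (Hv : sqrt (rho0 d * c0 d * k0 d) / sqrt t =
  rho0 d * c0 d * sqrt (alpha0 d * t) / t).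
{ rewrite <- sqrt_div_alt by trivial.
  apply sqrt_lem_1.
  - apply Rdiv_le_0_compat; nra.
  - apply Rdiv_le_0_compat; nra.
  - transitivity (rho0 d * c0 d * (rho0 d * c0 d) *
      (sqrt (alpha0 d * t) * sqrt (alpha0 d * t)) / (t * t)); [field; lra|].
    rewrite Hrr; unfold alpha0; field; repeat split; try lra; apply Rgt_not_eq, Hd. }
assert (Hk0r : k0 d = rho0 d * c0 d * (sqrt (alpha0 d * t) * sqrt (alpha0 d * t)) / t).
{ rewrite Hrr; unfold alpha0; field; repeat split; try lra; apply Rgt_not_eq, Hd. }
assert (Hmu : velocity d (T x t) t =
  mu_at d (f xi) * (rho0 d * c0 d * sqrt (alpha0 d * t) / t)).
{ rewrite <- Hv, HT; unfold velocity, mu_at; field.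
  pose proof sqrt_pos_data; lra. }
assert (HN : rhoT d (T x t) * cT d (T x t) = rho0 d * c0 d * N_at d (f xi)).
{ rewrite HT; unfold N_at; field; repeat split; apply Rgt_not_eq, Hd. }
pose proof (L_at_pos (f xi)).
rewrite Hmu, HN; unfold Tx; fold xi; unfold drift, kernel, resistivity.
rewrite Hk0r at 1; set (r := sqrt _) in *; field; lra.
Qed.

Lemma similarity_stefan_solution : stefan_solution d T s.
Proof.
pose proof alpha0_pos; pose proof rho0c0_pos.
pose proof (proj1 Hd) as HTm; pose proof M_const_pos; pose proof (L_at_pos 0).
assert (Hdata := Hd); destruct Hdata as (_&Hq&Hrho0&Hc0&Hk0&Hell).
split; [unfold s; rewrite Rmult_0_r, sqrt_0; ring|].
exists Tx; intros t Ht.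
assert (Hat : 0 < alpha0 d * t) by nra.
assert (Hr : 0 < sqrt (alpha0 d * t)) by now apply sqrt_lt_R0.
assert (Hs : 0 < s t) by (apply Rmult_lt_0_compat; lra).
assert (Hxis : s t / (2 * sqrt (alpha0 d * t)) = lam) by (unfold s; field; lra).
split; [trivial|]; split; [|split; [|split; [|split]]].
- intros x _; now apply is_derive_is_derive_within, Tx_derive.
- intros x Hx.
  eexists; eexists; split; [now apply Tt_derive|].
  split; [now apply flux_derive | now apply heat_equation].
- rewrite flux_eq by lra.
  replace (0 / (2 * sqrt (alpha0 d * t))) with 0 by (field; lra).
  unfold growth; rewrite RInt_point.
  change zero with 0; rewrite Rmult_0_r, exp_0.
  assert (0 < sqrt t) by now apply sqrt_lt_R0.
  assert (0 < sqrt (alpha0 d)) by now apply sqrt_lt_R0.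
  rewrite sqrt_mult by lra; unfold q_star; field; lra.
- unfold T, profile; rewrite Hxis, RInt_point.
  change zero with 0; ring.
- exists (lam * alpha0 d / sqrt (alpha0 d * t)); split.
  + unfold s; auto_derive; [trivial|].
    field; lra.
  + rewrite flux_eq by lra; rewrite Hxis.
    (* [L_at d 0] is [k(T_m) / k0], so the conductivity at the melting temperature cancels from the
       product. *)
    assert (HM : M_const d * L_at d 0 = 2 * ell d / (Tm d * c0 d)).
    { unfold M_const, L_at in *; rewrite Rmult_0_r, Rplus_0_l in *.
      field; repeat split; try lra.
      intros E; rewrite E in H2; unfold Rdiv in H2; lra. }
    rewrite HM in Hspeed.
    (* The first occurrence of [lam] is the argument of [expo f]; the second comes from the
       derivative of [s] and is the one to replace. *)
    rewrite <- Hspeed at 2; set (r := sqrt _) in *; unfold alpha0; field; lra.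
Qed.

End SimilaritySolution.

End Coefficients.

(** * Existence for the Stefan problem *)

Theorem theorem3p3 :
  forall (d : stefan_data) (b : stefan_bounds) (lam1 lam2 : R),
    positive_data d -> positive_bounds b ->
    hyp_K d b -> hyp_R d b -> hyp_V d b ->
    unique (fun lam => 0 < lam /\ V1 d b lam = lam) lam1 ->
    unique (fun lam => 0 < lam /\ V2 d b lam = lam) lam2 ->
    lam1 < lam2 ->
    E_q d b lam2 < 1 ->
    exists (lam : R) (f : R -> R) (T : R -> R -> R) (s : R -> R),
      lam1 < lam <= lam2 /\
      (lam = lam2 -> extremal_coefficients d b lam f) /\
      Vq d b lam lam /\
      unique_integral_solution d lam f /\
      (forall t, 0 < t -> s t = 2 * lam * sqrt (alpha0 d * t)) /\
      (forall x t, 0 < t -> 0 <= x / (2 * sqrt (alpha0 d * t)) <= lam ->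
         T x t = Tm d * f (x / (2 * sqrt (alpha0 d * t))) + Tm d) /\
      stefan_solution d T s.
Proof.
intros d b lam1 lam2 Hd Hb HK HR HV [[H1 HV1] _] [[H2 HV2] _] H12 HE.
destruct (speed_fixed_point d b Hd Hb HK HR HV lam2 H2 HE lam1) as [lam [Hlam Hfix]];
  trivial; [lra|].
pose (f := picard_limit (drift d) (resistivity d) (q_star d) lam).
assert (Hcont : forall x, continuous f x)
  by (apply (solution_cont d b) with lam2; trivial; lra).
assert (Hsol : solves (drift d) (resistivity d) (q_star d) lam f)
  by (apply (solution_solves d b) with lam2; trivial; lra).
assert (Huniq : unique_integral_solution d lam f)
  by (apply (solution_unique d b) with lam2; trivial; lra).
exists lam, f.
exists (fun x t => Tm d * profile d lam f (x / (2 * sqrt (alpha0 d * t))) + Tm d).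
exists (fun t => 2 * lam * sqrt (alpha0 d * t)).
split; [trivial|]; split; [|split; [|split; [|split; [|split]]]]; trivial.
(* At [lam2] the fixed-point equation says that [speed] and [V2] agree, which is the case of
   equality. *)
- intros ->; apply speed_eq_V2_extremal with lam2; trivial; lra.
- split.
  (* The threshold lies beyond [lam2], so [lam] belongs to the domain of [V^q]. *)
  + destruct (E_q_threshold d b Hd Hb lam2 H2 HE) as [lam_bar [Hbar Hlt]].
    exists lam_bar; split; [trivial | lra].
  + exists f; split; trivial.
    symmetry; transitivity (speed d lam); [|trivial].
    apply (speed_eq d b) with lam2; trivial; lra.
- intros x t Ht Hx; unfold profile; now rewrite <- (Hsol _ Hx).
- apply similarity_stefan_solution with b; trivial; lra.
Qed.
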